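(* Let $n\ge1$ be an integer, $x\in\mathbb{R}$, let $a=(a^{-1},a^0,\dots,a^{n})\in \mathbb{R}^{n+2}$ where $a^{-1} \le 0$, and suppose that $H_{m}(a)$ is SE-minimally positive and of rank $r \ge 1$, where $m$ is the integer part of $\tfrac 12 (n+1)$. If $n$ is even, suppose further that $a^{n}$ satisfies $$ a^{n} = \begin{bmatrix} a^m & a^{m+1} & \dots & a^{m+r-1}\end{bmatrix} H_r(a)^{-1} \begin{bmatrix} a^{m+1} \\ a^{m+2}\\ \vdots \\ a^{m+r} \end{bmatrix}. $$ Then the unique solution $F$ of Problem $\partial CF\mathcal{P}$ with data $x$, $a$ is $$ F(z)= \frac{a^{-1}}{z-x} + \frac{\sum_{j=0}^r \left(\sum_{k=0}^{j} c_k a^{j-k} \right) (z-x)^{j}}{\sum_{j=0}^r c_j (z-x)^j} $$ where $c_0 = -1$ and $$ \begin{bmatrix} c_r & c_{r-1} & \dots & c_1\end{bmatrix} = \begin{bmatrix} a^{r+1} & a^{r+2} & \dots & a^{2r} \end{bmatrix} H_r(a)^{-1}. $$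
   Context: Superscripts on $a$ are indices, not powers. $\Pi=\{z\in\mathbb{C}:\operatorname{Im} z>0\}$. The Pick class $\mathcal{P}$ is the set of analytic functions $f$ on $\Pi$ with $\operatorname{Im} f\ge 0$ on $\Pi$. For $x\in\mathbb{R}$, $f\in\mathcal{P}$ is meromorphic at $x$ if $f$ extends to a function analytic in a deleted neighbourhood of $x$ in $\mathbb{C}$ having at most a pole at $x$. Problem $\partial CF\mathcal{P}$: given $x\in\mathbb{R}$ and $a^{-1},a^0,\dots,a^n\in\mathbb{C}$, find $f\in\mathcal{P}$, meromorphic at $x$, such that $L_k(f,x)=a^k$ for $k=-1,0,1,\dots,n$, where $L_k(f,x)$ is the $k$th Laurent coefficient of $f$ at $x$. Such an $f$ is called a solution. For a positive integer $m$ with $2m-1\le n$, $H_m(a)=[a^{i+j-1}]_{i,j=1}^m$. ''Positive'' means positive semi-definite. $H_m(a)$ is SE-minimally positive if $H_m(a)\ge 0$ and, for every $\varepsilon>0$, $H_m(a)-\operatorname{diag}\{0,\dots,0,\varepsilon\}$ is not positive semi-definite. *)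

(* Defs.v *)
From HB Require Import structures.
From mathcomp Require Export all_boot all_order all_algebra.
From mathcomp Require Export all_classical all_reals all_analysis.
From mathcomp Require Export complex.

Set Implicit Arguments.
Unset Strict Implicit.
Unset Printing Implicit Defensive.

Export Order.TTheory GRing.Theory Num.Theory.
Export numFieldNormedType.Exports.

Local Open Scope classical_set_scope.
Local Open Scope ring_scope.
Local Open Scope complex_scope.

(* R[i] packaged as a numClosedFieldType, hence a numFieldType, from which it
   gets its topology. *)
Definition Cplx (R : realType) : numClosedFieldType := R[i].

Definition upper_half_plane (R : realType) : set (Cplx R) :=
  [set z | 0 < complex.Im z].

(* Analyticity is the existence of a power series expansion around the point:
   the series converges to f on a whole neighbourhood of z0. *)
Definition analytic_at (R : realType) (f : Cplx R -> Cplx R) (z0 : Cplx R) :=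
  exists c : nat -> Cplx R,
    \forall z \near z0, series (fun k => c k * (z - z0) ^+ k) @ \oo --> f z.

(* Functions on the half-plane are represented by total functions whose values
   off the half-plane are ignored. *)
Definition Pick (R : realType) (f : Cplx R -> Cplx R) :=
  (forall z, upper_half_plane z -> analytic_at f z) /\
  (forall z, upper_half_plane z -> 0 <= complex.Im (f z)).

Definition at_most_pole (R : realType) (g : Cplx R -> Cplx R) (p : Cplx R) :=
  exists (N : nat) (h : Cplx R -> Cplx R),
    analytic_at h p /\ \forall z \near p^', g z = h z / (z - p) ^+ N.

(* g witnesses that f is meromorphic at the real point x. *)
Definition meromorphic_extension (R : realType) (f : Cplx R -> Cplx R) (x : R)
    (g : Cplx R -> Cplx R) :=
  [/\ \forall z \near (x%:C : Cplx R)^', analytic_at g z,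
      \forall z \near (x%:C : Cplx R)^', upper_half_plane z -> g z = f z
    & at_most_pole g x%:C].

(* b k is the coefficient of (z - p)^k, k : int, in the Laurent expansion of g
   in a deleted neighbourhood of p; the principal part is finite, so the sum
   over k >= -N is an ordinary series after a shift of the index. *)
Definition laurent_coefs (R : realType) (g : Cplx R -> Cplx R) (p : Cplx R)
    (b : int -> Cplx R) :=
  exists N : nat,
    (forall k : int, k < - N%:Z -> b k = 0) /\
    \forall z \near p^',
      series (fun k : nat => b (k%:Z - N%:Z) * (z - p) ^ (k%:Z - N%:Z)) @ \oo
        --> g z.

(* Only the values a (-1), a 0, ..., a n of the data a are used. *)
Definition bCFP_solution (R : realType) (n : nat) (x : R) (a : int -> Cplx R)
    (f : Cplx R -> Cplx R) :=
  Pick f /\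
  exists (g : Cplx R -> Cplx R) (b : int -> Cplx R),
    [/\ meromorphic_extension f x g, laurent_coefs g x%:C b
      & forall k : int, -1 <= k <= n%:Z -> b k = a k].

(* Indices in 'I_m start at 0, so a^{i+j-1} becomes a (i + j + 1). *)
Definition Hankel (R : realType) (a : int -> R) (m : nat) : 'M[R]_m :=
  \matrix_(i < m, j < m) a (i + j + 1)%N.

Definition psd (R : realType) (m : nat) (A : 'M[R]_m) :=
  A^T = A /\ forall v : 'cV[R]_m, 0 <= (v^T *m A *m v) ord0 ord0.

Definition SE_minimally_positive (R : realType) (m : nat) (A : 'M[R]_m) :=
  psd A /\
  forall eps : R, 0 < eps ->
    ~ psd (A - diag_mx (\row_(i < m) (if i.+1 == m then eps else 0))).

Definition boundary_interpolant (R : realType) (x : R) (a : int -> R) (r : nat) (c : nat -> R)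
    (z : Cplx R) : Cplx R :=
  (a (-1))%:C / (z - x%:C) +
  (\sum_(0 <= j < r.+1)
     (\sum_(0 <= k < j.+1) c k * a (j - k)%N)%:C * (z - x%:C) ^+ j) /
  (\sum_(0 <= j < r.+1) (c j)%:C * (z - x%:C) ^+ j).

(* Main.v *)
Require Import Defs.
From mathcomp Require Import ring lra zify.

Set Implicit Arguments.
Unset Strict Implicit.
Unset Printing Implicit Defensive.

Local Open Scope classical_set_scope.
Local Open Scope ring_scope.
Local Open Scope complex_scope.

(** Write s = z - x, and F = a_(-1) / s + N / Q for the interpolant, where Q has the
    coefficients c and N those of the product of the series c and a, cut at degree r.

    The data. If the last basis vector were in the range of the Hankel matrix, the
    Cauchy-Schwarz inequality would allow a positive number to be subtracted from
    its last diagonal entry; so SE-minimality gives a kernel vector with nonzero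
    last entry ([SE_minimal_ker]). This makes the kernel stable under shifts, and
    the shifts of the shortest kernel vector say that a_1, a_2, ... satisfy a linear
    recurrence. Its order is the rank r < m, its coefficients are c, and the leading
    block H_r is positive definite ([hankel_structure]). For even n, the formula for a_n
    extends the recurrence to the index n ([hankel_last]).

    Existence. By the recurrence, N / Q has the Taylor coefficients a_0, ..., a_n at x
    ([reg_part_coef]). The Bezoutian of N and Q is congruent to H_r ([bezoutian]); at a
    point of the half-plane and its conjugate, this writes Im (N conj(Q)) as Im z times
    a value of the positive definite form H_r at a nonzero vector. So Q has no zero
    in the half-plane and Im (N / Q) >= 0 ([reg_part_Pick]).

    Uniqueness. A solution has at most a simple pole at x, and remains a Pick function
    when its pole is removed ([solution_regular]); the result f agrees with N / Q to
    order n + 1 >= 2 (r + 1). A boundary version of the Schur algorithm shows that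
    f = N / Q ([rigidity]). If f = a_0 + a_1 s + a_2 s^2 + ... is a Pick function with
    a_0, a_1, a_2 real and a_1 > 0, then so is -1 / (f - a_0) + 1 / (a_1 s), which is
    analytic at x ([julia_step]). This reduction lowers the degree of N / Q by one and
    the order of agreement by two, until a_1 = 0; then both functions are constant,
    because a zero of order at least 2 of f - a_0 would make Im f negative in a sector
    ([flat_constant]).

    The complex analysis needed is elementary. Sums, products and quotients of power
    series are handled by explicit remainder estimates ([taylor_at]); the local form
    c + b h^k (1 + O(h)) gives isolated zeros and the absence of local minima of Im f,
    hence the identity theorem and a minimum principle in the half-plane
    ([identity_theorem], [min_principle]). *)

(** * Modulus, real and imaginary parts *)

(** The real-valued modulus of a complex number. The norm [`|z|] is itself a
    complex number; estimates are made on [cabs z], in the ordered field R. *)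
Definition cabs (R : realType) (z : Cplx R) : R := Normc.normc z.
Local Notation Rez := (@complex.Re _).
Local Notation Imz := (@complex.Im _).

Section ComplexNumbers.
Context {R : realType}.
Implicit Types (z w : Cplx R) (t : R).

Lemma normr_cabs z : `|z| = (cabs z)%:C.
Proof. by []. Qed.

Lemma cabs_ge0 z : 0 <= cabs z.
Proof. by case: z => a b; exact: sqrtr_ge0. Qed.

Lemma cabsM z w : cabs (z * w) = cabs z * cabs w.
Proof. exact: Normc.normcM. Qed.

Lemma cabsV z : cabs z^-1 = (cabs z)^-1.
Proof. exact: Normc.normcV. Qed.

Lemma cabsN z : cabs (- z) = cabs z.
Proof. exact: normcN. Qed.

Lemma cabsD z w : cabs (z + w) <= cabs z + cabs w.
Proof. exact: le_normcD. Qed.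

Lemma cabs0 : cabs (0 : Cplx R) = 0.
Proof. exact: Normc.normc0. Qed.

Lemma cabs1 : cabs (1 : Cplx R) = 1.
Proof. exact: Normc.normc1. Qed.

Lemma cabsX z n : cabs (z ^+ n) = cabs z ^+ n.
Proof. by elim: n => [|n IH]; rewrite ?expr0 ?cabs1 // !exprS cabsM IH. Qed.

Lemma cabs_eq0 z : (cabs z == 0) = (z == 0).
Proof.
apply/eqP/eqP => [|->]; last exact: cabs0.
exact: Normc.eq0_normc.
Qed.

Lemma cabs_gt0 z : (0 < cabs z) = (z != 0).
Proof. by rewrite lt_def cabs_eq0 cabs_ge0 andbT. Qed.

Lemma cabsB z w : cabs (z - w) = cabs (w - z).
Proof. by rewrite -cabsN opprB. Qed.

Lemma cabs_real t : cabs (t%:C : Cplx R) = `|t|.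
Proof. by rewrite /cabs /= expr0n /= addr0 sqrtr_sqr. Qed.

Lemma cabs_sum (I : Type) (s : seq I) (P : pred I) (F : I -> Cplx R) :
  cabs (\sum_(i <- s | P i) F i) <= \sum_(i <- s | P i) cabs (F i).
Proof.
elim/big_rec2: _ => [|i y1 y2 _ IH]; first by rewrite cabs0.
by apply: le_trans (cabsD _ _) _; rewrite lerD2l.
Qed.

Lemma le_dist_cabs z w : cabs z - cabs w <= cabs (z - w).
Proof. by rewrite lerBlDr -{1}(subrK w z) cabsD. Qed.

Lemma cabs_sq z : cabs z ^+ 2 = Rez z ^+ 2 + Imz z ^+ 2.
Proof. by case: z => a b /=; rewrite sqr_sqrtr // addr_ge0 // sqr_ge0. Qed.

Lemma Re_le_cabs z : `|Rez z| <= cabs z.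
Proof.
rewrite -sqrtr_sqr; case: z => a b /=.
by rewrite ler_wsqrtr // lerDl sqr_ge0.
Qed.

Lemma Im_le_cabs z : `|Imz z| <= cabs z.
Proof.
rewrite -sqrtr_sqr; case: z => a b /=.
by rewrite ler_wsqrtr // lerDr sqr_ge0.
Qed.

Lemma cabs_le z : cabs z <= `|Rez z| + `|Imz z|.
Proof.
rewrite -(ler_pXn2r (n := 2)) ?nnegrE ?cabs_ge0 ?addr_ge0 //.
rewrite cabs_sq sqrrD !real_normK ?num_real //.
have : 0 <= `|Rez z| * `|Imz z| by rewrite mulr_ge0.
lra.
Qed.

Lemma ImD z w : Imz (z + w) = Imz z + Imz w.
Proof. by case: z w => a b [c d]. Qed.
Lemma ReD z w : Rez (z + w) = Rez z + Rez w.
Proof. by case: z w => a b [c d]. Qed.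
Lemma ImN z : Imz (- z) = - Imz z.
Proof. by case: z. Qed.
Lemma ReN z : Rez (- z) = - Rez z.
Proof. by case: z. Qed.
Lemma ImM z w : Imz (z * w) = Rez z * Imz w + Imz z * Rez w.
Proof. by case: z w => a b [c d]. Qed.
Lemma ReM z w : Rez (z * w) = Rez z * Rez w - Imz z * Imz w.
Proof. by case: z w => a b [c d]. Qed.
Lemma ImV z : Imz (z^-1) = - Imz z / cabs z ^+ 2.
Proof. by case: z => a b; rewrite cabs_sq /= ?mulNr. Qed.
Lemma ReV z : Rez (z^-1) = Rez z / cabs z ^+ 2.
Proof. by case: z => a b; rewrite cabs_sq /= ?mulNr. Qed.
Lemma ImC t : Imz (t%:C : Cplx R) = 0. Proof. by []. Qed.
Lemma ReC t : Rez (t%:C : Cplx R) = t. Proof. by []. Qed.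

Lemma cplx_eq z w : Rez z = Rez w -> Imz z = Imz w -> z = w.
Proof. by case: z w => a b [c d] /= -> ->. Qed.

Lemma nbhs_cabsP z (P : Cplx R -> Prop) :
  (\forall w \near z, P w) <->
  exists2 e : R, 0 < e & forall w, cabs (w - z) < e -> P w.
Proof.
split.
  move=> /nbhs_ballP [e /= e0 H].
  have [er eE] : exists t : R, e = t%:C.
    by apply/complex_realP; exact: gtr0_real.
  exists er; first by move: e0; rewrite eE ltcR.
  move=> w Hw; apply: H.
  by rewrite -ball_normE /= distrC normr_cabs eE ltcR.
move=> [e e0 H]; apply/nbhs_ballP; exists (e%:C); first by rewrite /= ltcR.
move=> w; rewrite -ball_normE /= distrC normr_cabs ltcR; exact: H.
Qed.

End ComplexNumbers.

(** * Power series expansions *)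

(** The sum of c_k h^k over k < K: the K-th partial sum, of degree below K. *)
Definition taylor_sum (R : realType) (c : nat -> Cplx R) (h : Cplx R) (K : nat) :
  Cplx R :=
  \sum_(k < K) c k * h ^+ k.

(** The coefficients of the product of two power series. *)
Definition cauchy_prod (T : comNzRingType) (c d : nat -> T) k : T :=
  \sum_(i < k.+1) c i * d (k - i)%N.

(** f has the Taylor series with coefficients c at p: for z near p, every
    remainder of order K is at most M (k |z - p|)^K, with M and k independent
    of z and K. This is equivalent to convergence of the series to f near p
    ([taylor_series], [series_taylor]), but sums, products and inverses are
    estimated on it without passing to the limit. *)
Definition taylor_at (R : realType) (c : nat -> Cplx R) (f : Cplx R -> Cplx R)
    (p : Cplx R) : Prop :=
  exists M k e : R, [/\ 0 <= M, 0 < k, 0 < e &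
    forall z, cabs (z - p) < e -> forall K,
      cabs (f z - taylor_sum c (z - p) K) <= M * (k * cabs (z - p)) ^+ K].

(** Analyticity in terms of [taylor_at]; see [analytic_atP]. *)
Definition regular_at (R : realType) (f : Cplx R -> Cplx R) (p : Cplx R) : Prop :=
  exists c, taylor_at c f p.

Section PowerSeries.
Context {R : realType}.
Implicit Types (f g : Cplx R -> Cplx R) (c d : nat -> Cplx R) (p z : Cplx R).

Lemma taylor_sum0 c h : taylor_sum c h 0 = 0.
Proof. by rewrite /taylor_sum big_ord0. Qed.

Lemma taylor_sumS c h K : taylor_sum c h K.+1 = taylor_sum c h K + c K * h ^+ K.
Proof. by rewrite /taylor_sum big_ord_recr. Qed.

Lemma taylor_sum_at0 c K : taylor_sum c 0 K.+1 = c 0%N.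
Proof.
rewrite /taylor_sum big_ord_recl expr0 mulr1 big1 ?addr0 // => i _.
by rewrite expr0n mulr0.
Qed.

Lemma taylor_val c f p : taylor_at c f p -> f p = c 0%N.
Proof.
move=> [M [k [e [M0 k0 e0 H]]]].
have := H p; rewrite subrr cabs0 => /(_ e0 1%N).
rewrite mulr0 expr1 mulr0 taylor_sum_at0 => le0.
apply/eqP; rewrite -subr_eq0 -cabs_eq0; apply/eqP/le_anti.
by rewrite le0 cabs_ge0.
Qed.

Lemma taylor_near c f g p : (\forall z \near p, f z = g z) -> taylor_at c f p ->
  taylor_at c g p.
Proof.
move=> /nbhs_cabsP[e1 e10 fg] [M [k [e [M0 k0 e0 H]]]].
exists M, k, (Num.min e e1); split => //; first by rewrite lt_min e0.
move=> z; rewrite lt_min => /andP[ze ze1] K.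
by rewrite -fg // H.
Qed.

Lemma taylor_ext c d f p : (forall k, c k = d k) -> taylor_at c f p -> taylor_at d f p.
Proof. by move=> /funext ->. Qed.

(** The constants M and k may be increased and the radius e decreased. *)
Lemma taylor_weaken c f p M k e M' k' e' :
  0 <= M -> 0 < k -> M <= M' -> k <= k' -> e' <= e ->
  (forall z, cabs (z - p) < e -> forall K,
      cabs (f z - taylor_sum c (z - p) K) <= M * (k * cabs (z - p)) ^+ K) ->
  (forall z, cabs (z - p) < e' -> forall K,
      cabs (f z - taylor_sum c (z - p) K) <= M' * (k' * cabs (z - p)) ^+ K).
Proof.
move=> M0 k0 MM kk ee H z ze K.
apply: (le_trans (H z (lt_le_trans ze ee) K)).
apply: ler_pM => //; first by rewrite exprn_ge0 // mulr_ge0 ?cabs_ge0 // ltW.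
apply: lerXn2r; rewrite ?nnegrE ?mulr_ge0 ?cabs_ge0 // ?(ltW k0) //.
  exact: le_trans (ltW k0) kk.
by rewrite ler_wpM2r ?cabs_ge0.
Qed.

(** Two expansions at p have common constants, with a radius on which the
    remainders decay geometrically with ratio at most 1/2. *)
Lemma taylor_common c d f g p : taylor_at c f p -> taylor_at d g p ->
  exists M k e : R, [/\ 0 < M, 0 < k, 0 < e, k * e <= 1 / 2 &
    forall z, cabs (z - p) < e -> forall K,
      cabs (f z - taylor_sum c (z - p) K) <= M * (k * cabs (z - p)) ^+ K /\
      cabs (g z - taylor_sum d (z - p) K) <= M * (k * cabs (z - p)) ^+ K].
Proof.
move=> [M [k [e [M0 k0 e0 H]]]] [M' [k' [e' [M0' k0' e0' H']]]].
have kk : 0 < k + k' by rewrite addr_gt0.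
exists (M + M' + 1), (k + k'), (Num.min (Num.min e e') (1 / 2 / (k + k'))).
have MM : 0 <= M + M' by rewrite addr_ge0.
split => //.
- by rewrite ltr_wpDl.
- by rewrite !lt_min e0 e0' /= divr_gt0.
- by rewrite mulrC -ler_pdivlMr // ge_min lexx orbT.
move=> z ze K; split.
  apply: (taylor_weaken M0 k0 _ _ _ H ze); first lra; first lra.
  by rewrite !ge_min lexx.
apply: (taylor_weaken M0' k0' _ _ _ H' ze); first lra; first lra.
by rewrite !ge_min lexx !orbT.
Qed.

Lemma taylor_nice c f p : taylor_at c f p ->
  exists M k e : R, [/\ 0 < M, 0 < k, 0 < e, k * e <= 1 / 2 &
    forall z, cabs (z - p) < e -> forall K,
      cabs (f z - taylor_sum c (z - p) K) <= M * (k * cabs (z - p)) ^+ K].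
Proof.
move=> H; have [M [k [e [M0 k0 e0 ke HH]]]] := taylor_common H H.
by exists M, k, e; split => // z ze K; have [] := HH z ze K.
Qed.

Lemma exists_cabs p (e : R) : 0 < e -> exists z, cabs (z - p) = e.
Proof.
move=> e0; exists (p + e%:C).
by rewrite addrC addKr cabs_real gtr0_norm.
Qed.

(** Cauchy estimates: c_j h^j is the difference of two consecutive remainders. *)
Lemma coef_bound c f p : taylor_at c f p ->
  exists M k : R, [/\ 0 < M, 0 < k & forall j, cabs (c j) <= M * k ^+ j].
Proof.
move=> /taylor_nice [M [k [e [M0 k0 e0 ke H]]]].
exists (M * 2), k; split => //; first by rewrite mulr_gt0.
move=> j.
have [z ze] := @exists_cabs p (e / 2) (divr_gt0 e0 (ltr0Sn _ 1)).
have ze' : cabs (z - p) < e by rewrite ze; lra.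
have h0 : 0 < cabs (z - p) by rewrite ze divr_gt0.
have := H z ze' j; have := H z ze' j.+1; rewrite taylor_sumS.
set E := f z - _ => h2; set E' := f z - _ => h1.
have cE : c j * (z - p) ^+ j = E' - E by rewrite /E /E'; ring.
have : cabs (c j) * cabs (z - p) ^+ j <= M * 2 * k ^+ j * cabs (z - p) ^+ j.
  rewrite -cabsX -cabsM cE cabsX; apply: le_trans (cabsD _ _) _; rewrite cabsN.
  apply: le_trans (lerD h1 h2) _.
  have -> : M * 2 * k ^+ j * cabs (z - p) ^+ j = 2 * (M * (k * cabs (z - p)) ^+ j).
    by rewrite exprMn; ring.
  rewrite exprS.
  set t := _ ^+ j; set u := k * _.
  have t0 : 0 <= t by rewrite exprn_ge0 // mulr_ge0 // ltW.
  have u1 : u <= 1.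
    apply: le_trans (_ : k * e <= _); first by rewrite ler_wpM2l // ltW.
    lra.
  have : M * (u * t) <= M * t by rewrite ler_wpM2l ?(ltW M0) // ler_piMl.
  lra.
by rewrite ler_pM2r // exprn_gt0.
Qed.

Lemma taylor_cst (a : Cplx R) p :
  taylor_at (fun k => if k is 0 then a else 0) (fun=> a) p.
Proof.
exists (cabs a), 1, 1; split => //; first exact: cabs_ge0.
move=> z ze [|K]; first by rewrite taylor_sum0 subr0 expr0 mulr1.
rewrite /taylor_sum big_ord_recl big1 => [|i _]; last by rewrite mul0r.
by rewrite /= expr0 mulr1 addr0 subrr cabs0 mulr_ge0 ?cabs_ge0 // exprn_ge0 // mul1r cabs_ge0.
Qed.

Lemma taylor_add c d f g p : taylor_at c f p -> taylor_at d g p ->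
  taylor_at (fun k => c k + d k) (fun z => f z + g z) p.
Proof.
move=> H1 H2; have [M [k [e [M0 k0 e0 ke H]]]] := taylor_common H1 H2.
exists (M *+ 2), k, e; split => //; first by rewrite mulrn_wge0 // ltW.
move=> z ze K; have [h1 h2] := H z ze K.
have -> : taylor_sum (fun k => c k + d k) (z - p) K = taylor_sum c (z - p) K + taylor_sum d (z - p) K.
  by rewrite /taylor_sum -big_split /=; apply: eq_bigr => i _; rewrite mulrDl.
rewrite opprD addrACA mulr2n mulrDl.
by apply: le_trans (cabsD _ _) _; apply: lerD.
Qed.

Lemma taylor_sum_scale a c h K :
  taylor_sum (fun k => a * c k) h K = a * taylor_sum c h K.
Proof. by rewrite /taylor_sum mulr_sumr; apply: eq_bigr => i _; rewrite mulrA. Qed.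

Lemma taylor_scale a c f p : taylor_at c f p ->
  taylor_at (fun k => a * c k) (fun z => a * f z) p.
Proof.
move=> [M [k [e [M0 k0 e0 H]]]].
exists (cabs a * M), k, e; split => //; first by rewrite mulr_ge0 ?cabs_ge0.
move=> z ze K; rewrite taylor_sum_scale -mulrBr cabsM -mulrA ler_wpM2l ?cabs_ge0 //.
exact: H.
Qed.

Lemma taylor_sub c d f g p : taylor_at c f p -> taylor_at d g p ->
  taylor_at (fun k => c k - d k) (fun z => f z - g z) p.
Proof.
move=> H1 H2; have := taylor_add H1 (taylor_scale (-1) H2).
have -> : (fun k => c k + -1 * d k) = (fun k => c k - d k).
  by apply/funext => k; rewrite mulN1r.
have -> // : (fun z => f z + -1 * g z) = (fun z => f z - g z).
by apply/funext => k; rewrite mulN1r.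
Qed.

Lemma taylor_sum_cauchy_prod c d h K :
  taylor_sum (cauchy_prod c d) h K = \sum_(i < K) c i * h ^+ i * taylor_sum d h (K - i).
Proof.
elim: K => [|K IH]; first by rewrite taylor_sum0 big_ord0.
rewrite taylor_sumS IH big_ord_recr /= subSnn taylor_sumS taylor_sum0 add0r expr0 mulr1.
rewrite /cauchy_prod big_ord_recr /= subnn mulrDl -mulrA.
rewrite !addrA; congr (_ + _); last by rewrite mulrCA mulrC mulrA.
rewrite mulr_suml -big_split /=; apply: eq_bigr => i _.
rewrite subSn ?(ltnW (ltn_ord i)) // taylor_sumS mulrDr; congr (_ + _).
have -> : h ^+ K = h ^+ i * h ^+ (K - i) by rewrite -exprD subnKC // ltnW.
ring.
Qed.

(** The product of a partial sum by g differs from the partial sum of the product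
    by K terms c_i h^i (g - S_(K - i)(d)), each at most M^2 (k |h|)^K; the factor K is
    absorbed in 2^K. *)
Lemma cauchy_prod_error c d (g : Cplx R) (h : Cplx R) (M k : R) K :
  0 <= M -> 0 <= k ->
  (forall j, cabs (c j) <= M * k ^+ j) ->
  (forall j, cabs (g - taylor_sum d h j) <= M * (k * cabs h) ^+ j) ->
  cabs (taylor_sum c h K * g - taylor_sum (cauchy_prod c d) h K) <= M * M * (2 * k * cabs h) ^+ K.
Proof.
move=> M0 k0 cb gb; have kh0 : 0 <= k * cabs h by rewrite mulr_ge0 ?cabs_ge0.
rewrite taylor_sum_cauchy_prod {1}/taylor_sum mulr_suml -sumrB.
apply: le_trans (cabs_sum _ _ _) _.
apply: le_trans (_ : \sum_(i < K) M * M * (k * cabs h) ^+ K <= _).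
  apply: ler_sum => i _; rewrite -mulrBr !cabsM cabsX.
  have -> : M * M * (k * cabs h) ^+ K =
      (M * (k * cabs h) ^+ i) * (M * (k * cabs h) ^+ (K - i)).
    by rewrite mulrACA -exprD subnKC // ltnW.
  apply: ler_pM; rewrite ?mulr_ge0 ?cabs_ge0 ?exprn_ge0 ?cabs_ge0 //.
  by rewrite exprMn mulrA ler_wpM2r ?exprn_ge0 ?cabs_ge0.
rewrite sumr_const card_ord -[_ *+ K]mulr_natl mulrCA -(mulrA 2 k) [(2 * _) ^+ K]exprMn.
rewrite ler_wpM2l ?mulr_ge0 // ler_wpM2r ?exprn_ge0 //.
rewrite -natrX ler_nat; exact: ltnW (ltn_expl _ _).
Qed.

Lemma taylor_mul c d f g p : taylor_at c f p -> taylor_at d g p ->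
  taylor_at (cauchy_prod c d) (fun z => f z * g z) p.
Proof.
move=> H1 H2; have [M1 [k1 [M10 k10 cb]]] := coef_bound H1.
have [M [k [e [M0 k0 e0 ke H]]]] := taylor_common H1 H2.
pose k2 := k + k1; pose M2 := M + M1.
have k20 : 0 < k2 by rewrite addr_gt0.
have M20 : 0 < M2 by rewrite addr_gt0.
have cb2 j : cabs (c j) <= M2 * k2 ^+ j.
  apply: le_trans (cb j) _; apply: ler_pM; rewrite ?exprn_ge0 ?(ltW M10) ?(ltW k10) //.
    rewrite /M2; lra.
  by apply: lerXn2r; rewrite ?nnegrE ?ltW // /k2; lra.
exists (M2 * M2 *+ 2), (2 * k2), e; split => //.
- by rewrite mulrn_wge0 // mulr_ge0 ?ltW.
- by rewrite mulr_gt0.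
move=> z ze K.
have kh : 0 <= k * cabs (z - p) by rewrite mulr_ge0 ?cabs_ge0 // ltW.
have kkh : k * cabs (z - p) <= k2 * cabs (z - p) by rewrite ler_wpM2r ?cabs_ge0 // /k2; lra.
have gb j : cabs (g z - taylor_sum d (z - p) j) <= M2 * (k2 * cabs (z - p)) ^+ j.
  have [_ h] := H z ze j; apply: le_trans h _.
  apply: ler_pM; rewrite ?exprn_ge0 ?(ltW M0) //; first by rewrite /M2; lra.
  by apply: lerXn2r; rewrite ?nnegrE // (le_trans kh).
have ce := cauchy_prod_error K (ltW M20) (ltW k20) cb2 gb.
have [hf _] := H z ze K.
have fE : cabs ((f z - taylor_sum c (z - p) K) * g z) <= M2 * M2 * (2 * k2 * cabs (z - p)) ^+ K.
  rewrite cabsM mulrAC; apply: ler_pM; rewrite ?cabs_ge0 //; last first.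
    by have := gb 0%N; rewrite taylor_sum0 subr0 expr0 mulr1.
  apply: le_trans hf _; apply: ler_pM; rewrite ?exprn_ge0 ?(ltW M0) //.
    rewrite /M2; lra.
  apply: lerXn2r; rewrite ?nnegrE //; last by rewrite -mulrA; lra.
  by rewrite -mulrA; lra.
rewrite mulr2n mulrDl.
have -> : f z * g z - taylor_sum (cauchy_prod c d) (z - p) K =
  (f z - taylor_sum c (z - p) K) * g z +
  (taylor_sum c (z - p) K * g z - taylor_sum (cauchy_prod c d) (z - p) K).
  by ring.
by apply: le_trans (cabsD _ _) _; apply: lerD.
Qed.

End PowerSeries.

(** * Analytic functions *)

Section Analytic.
Context {R : realType}.
Implicit Types (f g : Cplx R -> Cplx R) (c d : nat -> Cplx R) (p z : Cplx R).

(** The list of the coefficients of index at most n of the inverse power series,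
    computed from the relation cauchy_prod d c = 1. *)
Fixpoint inv_list c n : seq (Cplx R) :=
  if n is n'.+1 then
    let l := inv_list c n' in
    rcons l (- (c 0%N)^-1 * \sum_(i < n'.+1) nth 0 l i * c (n'.+1 - i)%N)
  else [:: (c 0%N)^-1].

(** The coefficients of the inverse of the power series c (for c_0 nonzero). *)
Definition inv_coef c n := nth 0 (inv_list c n) n.

Lemma size_inv_list c n : size (inv_list c n) = n.+1.
Proof. by elim: n => //= n IH; rewrite size_rcons IH. Qed.

Lemma nth_inv_list c n k : (k <= n)%N -> nth 0 (inv_list c n) k = inv_coef c k.
Proof.
elim: n => [|n IH]; first by rewrite leqn0 => /eqP ->.
rewrite leq_eqVlt => /orP[/eqP ->//|kn].
by rewrite /= nth_rcons size_inv_list kn IH.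
Qed.

Lemma inv_coefS c n : inv_coef c n.+1 =
  - (c 0%N)^-1 * \sum_(i < n.+1) inv_coef c i * c (n.+1 - i)%N.
Proof.
rewrite /inv_coef /= nth_rcons size_inv_list ltnn eqxx; congr (_ * _).
by apply: eq_bigr => i _; rewrite nth_inv_list // -ltnS.
Qed.

Lemma cauchy_prod_inv_coef c k : c 0%N != 0 ->
  cauchy_prod (inv_coef c) c k = (k == 0%N)%:R.
Proof.
move=> c0; case: k => [|k]; rewrite /cauchy_prod big_ord_recr /= subnn.
  by rewrite big_ord0 add0r /inv_coef /= mulVf.
by rewrite inv_coefS mulrAC mulNr mulVf // mulN1r subrr.
Qed.

(** The ratio k (1 + A M) makes the recursive estimate a telescoping sum
    ([subrXX]). *)
Lemma inv_coef_bound c (M k : R) : 0 <= M -> 0 < k ->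
  (forall j, cabs (c j) <= M * k ^+ j) ->
  let A := cabs (c 0%N)^-1 in
  forall j, cabs (inv_coef c j) <= A * (k * (1 + A * M)) ^+ j.
Proof.
move=> M0 k0 cb A; set L := k * _.
have A0 : 0 <= A by rewrite cabs_ge0.
have AM : 0 <= A * M by rewrite mulr_ge0.
have L0 : 0 <= L by rewrite mulr_ge0 ?(ltW k0) // addr_ge0.
elim/ltn_ind => -[|n] IH; first by rewrite expr0 mulr1 /inv_coef /=.
rewrite inv_coefS cabsM cabsN -/A ler_wpM2l //.
apply: le_trans (cabs_sum _ _ _) _.
apply: (@le_trans _ _ (\sum_(i < n.+1) (A * M * k) * (k ^+ (n.+1.-1 - i) * L ^+ i))).
  apply: ler_sum => i _; rewrite cabsM.
  have -> : A * M * k * (k ^+ (n.+1.-1 - i) * L ^+ i) =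
      A * L ^+ i * (M * k ^+ (n.+1 - i)).
    by rewrite subSn /=; [rewrite exprS; ring | rewrite -ltnS].
  by apply: ler_pM; rewrite ?cabs_ge0 // IH.
rewrite -mulr_sumr.
have -> : A * M * k = - (k - L) by rewrite /L; ring.
by rewrite mulNr -subrXX opprB lerBlDr lerDl exprn_ge0 // ltW.
Qed.

Lemma taylor_near_val c f p : taylor_at c f p -> forall e, 0 < e ->
  \forall z \near p, cabs (f z - f p) < e.
Proof.
move=> H e e0; rewrite (taylor_val H); case: H => M [k [r [M0 k0 r0 H]]].
apply/nbhs_cabsP; exists (Num.min r (e / (M * k + 1))).
  by rewrite lt_min r0 divr_gt0 // ltr_wpDl // mulr_ge0 // ltW.
move=> z; rewrite lt_min => /andP[zr]; rewrite ltr_pdivlMr; last first.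
  by rewrite ltr_wpDl // mulr_ge0 // ltW.
have := H z zr 1%N; rewrite taylor_sumS taylor_sum0 add0r !expr0 expr1 mulr1 => h1 h2.
apply: (le_lt_trans h1); apply: le_lt_trans h2.
rewrite mulrA mulrC ler_wpM2l ?cabs_ge0 // ?lerDl //.
Qed.

Lemma regular_near_val f p : regular_at f p -> forall e, 0 < e ->
  \forall z \near p, cabs (f z - f p) < e.
Proof. by move=> [c H]; exact: taylor_near_val H. Qed.

Lemma regular_neq0_near f p : regular_at f p -> f p != 0 ->
  \forall z \near p, f z != 0.
Proof.
move=> fA fp; have := regular_near_val fA; rewrite -cabs_gt0 in fp; move=> /(_ _ fp).
apply: filterS => z; apply: contraTneq => ->.
by rewrite sub0r cabsN ltxx.
Qed.

Lemma taylor_inv c f p : taylor_at c f p -> f p != 0 ->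
  taylor_at (inv_coef c) (fun z => (f z)^-1) p.
Proof.
move=> H fp; have c0 : c 0%N != 0 by rewrite -(taylor_val H).
have nc0 : 0 < cabs (c 0%N) by rewrite cabs_gt0.
have [M1 [k1 [M10 k10 cb]]] := coef_bound H.
have [M [k [e [M0 k0 e0 ke HH]]]] := taylor_nice H.
pose A := cabs (c 0%N)^-1.
have A0 : 0 <= A by rewrite cabs_ge0.
have AM : 0 <= A * M1 by rewrite mulr_ge0 ?(ltW M10).
have db := inv_coef_bound (ltW M10) k10 cb; rewrite -/A /= in db.
pose k2 := k + k1 * (1 + A * M1); pose M2 := M + A.
have k1A : 0 <= k1 * (1 + A * M1) by rewrite mulr_ge0 ?(ltW k10) // addr_ge0.
have k20 : 0 < k2 by rewrite ltr_pwDl.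
have M20 : 0 < M2 by rewrite ltr_pwDl.
have [r r0 hr] := (proj1 (nbhs_cabsP _ _)) (taylor_near_val H (divr_gt0 nc0 (ltr0Sn _ 1))).
exists ((M2 * M2 + 1) * (2 / cabs (c 0%N))), (2 * k2), (Num.min e r).
have B0 : 0 <= 2 / cabs (c 0%N) by rewrite divr_ge0 // ltW.
split.
- by rewrite mulr_ge0 // addr_ge0 // mulr_ge0 // ltW.
- by rewrite mulr_gt0.
- by rewrite lt_min e0.
move=> z; rewrite lt_min => /andP[ze zr] K.
have fz : cabs (c 0%N) / 2 <= cabs (f z).
  have := hr z zr; rewrite (taylor_val H) cabsB => h.
  by have := le_dist_cabs (c 0%N) (f z); lra.
have fz0 : 0 < cabs (f z) by apply: lt_le_trans fz; rewrite divr_gt0.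
have fzi : cabs (f z)^-1 <= 2 / cabs (c 0%N).
  rewrite cabsV -[X in _ <= X]invrK lef_pV2 ?posrE ?invr_gt0 ?divr_gt0 //.
  by rewrite invf_div.
have kh : 0 <= k * cabs (z - p) by rewrite mulr_ge0 ?cabs_ge0 // ltW.
have kkh : k * cabs (z - p) <= k2 * cabs (z - p) by rewrite ler_wpM2r ?cabs_ge0 // /k2; lra.
have t0 : 0 <= (2 * k2 * cabs (z - p)) ^+ K.
  by rewrite exprn_ge0 // !mulr_ge0 ?cabs_ge0 // ltW.
have db2 j : cabs (inv_coef c j) <= M2 * k2 ^+ j.
  apply: le_trans (db j) _; apply: ler_pM; rewrite ?exprn_ge0 //.
    rewrite /M2; lra.
  by apply: lerXn2r; rewrite ?nnegrE // ?(ltW k20) // lerDr ltW.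
have gb j : cabs (f z - taylor_sum c (z - p) j) <= M2 * (k2 * cabs (z - p)) ^+ j.
  apply: le_trans (HH z ze j) _.
  apply: ler_pM; rewrite ?exprn_ge0 ?(ltW M0) //; first by rewrite /M2; lra.
  by apply: lerXn2r; rewrite ?nnegrE // (le_trans kh).
have ce := cauchy_prod_error K (ltW M20) (ltW k20) db2 gb.
case: K t0 ce => [|K] t0 ce.
  rewrite taylor_sum0 subr0 expr0 mulr1; apply: le_trans fzi _.
  by rewrite ler_peMl // lerDr mulr_ge0 // ltW.
have psd : taylor_sum (cauchy_prod (inv_coef c) c) (z - p) K.+1 = 1.
  rewrite /taylor_sum big_ord_recl cauchy_prod_inv_coef // expr0 mulr1 big1 ?addr0 // => i _.
  by rewrite cauchy_prod_inv_coef // mul0r.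
rewrite psd in ce.
have -> : (f z)^-1 - taylor_sum (inv_coef c) (z - p) K.+1 =
    - (taylor_sum (inv_coef c) (z - p) K.+1 * f z - 1) * (f z)^-1.
  have fzn : f z != 0 by rewrite -cabs_gt0.
  by field.
rewrite cabsM cabsN [X in _ <= X]mulrAC; apply: ler_pM; rewrite ?cabs_ge0 //.
by apply: le_trans ce _; rewrite ler_wpM2r // lerDl.
Qed.

Lemma regular_near f g p : (\forall z \near p, f z = g z) -> regular_at f p ->
  regular_at g p.
Proof. by move=> fg [c H]; exists c; exact: taylor_near H. Qed.

Lemma regular_cst (a : Cplx R) p : regular_at (fun=> a) p.
Proof. by eexists; exact: taylor_cst. Qed.

Lemma regular_add f g p : regular_at f p -> regular_at g p ->
  regular_at (fun z => f z + g z) p.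
Proof. by move=> [c H] [d H']; eexists; exact: taylor_add H H'. Qed.

Lemma regular_sub f g p : regular_at f p -> regular_at g p ->
  regular_at (fun z => f z - g z) p.
Proof. by move=> [c H] [d H']; eexists; exact: taylor_sub H H'. Qed.

Lemma regular_mul f g p : regular_at f p -> regular_at g p ->
  regular_at (fun z => f z * g z) p.
Proof. by move=> [c H] [d H']; eexists; exact: taylor_mul H H'. Qed.

Lemma regular_inv f p : regular_at f p -> f p != 0 -> regular_at (fun z => (f z)^-1) p.
Proof. by move=> [c H] fp; eexists; exact: taylor_inv H fp. Qed.

Lemma regular_div f g p : regular_at f p -> regular_at g p -> g p != 0 ->
  regular_at (fun z => f z / g z) p.
Proof. by move=> fA gA gp; apply: regular_mul => //; exact: regular_inv. Qed.

Lemma taylor_poly (P : {poly Cplx R}) p :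
  taylor_at (fun k => P`_k) (fun z => P.[z - p]) p.
Proof.
exists (\sum_(i < size P) cabs P`_i), 1, 1; split => //.
  by apply: sumr_ge0 => i _; exact: cabs_ge0.
move=> z z1 K; rewrite mul1r; set h := z - p.
have h0 : 0 <= cabs h by exact: cabs_ge0.
have hK : 0 <= cabs h ^+ K by rewrite exprn_ge0.
have pE n : taylor_sum (fun k => P`_k) h n = \sum_(0 <= i < n) P`_i * h ^+ i.
  by rewrite /taylor_sum big_mkord.
have -> : P.[h] = taylor_sum (fun k => P`_k) h (size P) by rewrite horner_coef.
have [Ks|sK] := leqP K (size P); last first.
  rewrite !pE (big_cat_nat (leq0n _) (ltnW sK)) /= [\sum_(size P <= i < K) _]big1_seq.
    by rewrite addr0 subrr cabs0 mulr_ge0 // sumr_ge0 // => i _; exact: cabs_ge0.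
  move=> i; rewrite mem_index_iota => /andP[_ /andP[si _]].
  by rewrite nth_default // mul0r.
rewrite !pE (big_cat_nat (leq0n _) Ks) /= addrAC subrr add0r mulr_suml.
apply: le_trans (cabs_sum _ _ _) _.
rewrite -(big_mkord xpredT (fun i => cabs P`_i * cabs h ^+ K)).
rewrite (big_cat_nat (leq0n _) Ks) /= ler_wpDl //.
  by apply: sumr_ge0 => i _; rewrite mulr_ge0 ?cabs_ge0.
rewrite big_nat_cond [X in _ <= X]big_nat_cond.
apply: ler_sum => i /andP[/andP[Ki _] _]; rewrite cabsM cabsX ler_wpM2l ?cabs_ge0 //.
by apply: ler_wiXn2l => //; exact: ltW.
Qed.

Lemma regular_horner (P : {poly Cplx R}) x p : regular_at (fun z => P.[z - x]) p.
Proof.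
exists (fun k => (P \Po ('X + (p - x)%:P))`_k).
apply: taylor_near (taylor_poly _ p); near=> z.
rewrite horner_comp hornerD hornerX hornerC; congr (_.[_]).
by rewrite addrA subrK.
Unshelve. all: by end_near. Qed.

Lemma regular_id p x : regular_at (fun z => z - x) p.
Proof.
apply: regular_near (regular_horner 'X x p); near=> z; by rewrite hornerX.
Unshelve. all: by end_near. Qed.

Lemma taylor_sum_shift c k h K : (forall j, (j < k)%N -> c j = 0) ->
  taylor_sum c h (K + k) = h ^+ k * taylor_sum (fun j => c (j + k)%N) h K.
Proof.
move=> c0; rewrite addnC /taylor_sum big_split_ord /= big1 => [|i _]; last first.
  by rewrite c0 ?mul0r.
rewrite add0r mulr_sumr; apply: eq_bigr => i _.
by rewrite exprD addnC; ring.
Qed.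

(** Division by (z - p)^k of a function vanishing to order k at p. *)
Lemma taylor_shift c f p k : (forall j, (j < k)%N -> c j = 0) -> taylor_at c f p ->
  taylor_at (fun j => c (j + k)%N)
     (fun z => if z == p then c k else f z / (z - p) ^+ k) p.
Proof.
move=> c0 [M [t [e [M0 t0 e0 H]]]].
have tk : 0 <= M * t ^+ k by rewrite mulr_ge0 // exprn_ge0 // ltW.
exists (M * t ^+ k + cabs (c k)), t, e; split => //.
  by rewrite addr_ge0 ?cabs_ge0.
move=> z ze K; case: eqVneq => [->|zp].
  rewrite subrr cabs0 mulr0; case: K => [|K].
    by rewrite taylor_sum0 subr0 expr0 mulr1 lerDr.
  by rewrite taylor_sum_at0 add0n subrr cabs0 expr0n mulr0.
have h0 : z - p != 0 by rewrite subr_eq0.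
have := H z ze (K + k)%N; rewrite taylor_sum_shift // => h.
rewrite -(ler_pM2r (x := cabs (z - p) ^+ k)); last by rewrite exprn_gt0 ?cabs_gt0.
rewrite -cabsX -cabsM mulrBl divfK ?expf_neq0 // [taylor_sum _ _ _ * _]mulrC.
apply: le_trans h _; rewrite exprD [X in _ * (_ * X)]exprMn cabsX.
have -> : M * ((t * cabs (z - p)) ^+ K * (t ^+ k * cabs (z - p) ^+ k)) =
   M * t ^+ k * (t * cabs (z - p)) ^+ K * cabs (z - p) ^+ k by ring.
rewrite !ler_wpM2r ?exprn_ge0 ?cabs_ge0 ?mulr_ge0 ?cabs_ge0 ?(ltW t0) //.
by rewrite lerDl cabs_ge0.
Qed.

Lemma le0_geometric (t M : R) : (forall K, t <= M * (1 / 2) ^+ K) -> t <= 0.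
Proof.
move=> H; rewrite leNgt; apply/negP => t0.
have M0 : 0 < M by apply: lt_le_trans t0 _; have := H 0%N; rewrite expr0 mulr1.
have := H (Num.bound (M / t)); set K := Num.bound _.
have MK : M / t < K%:R by apply: archi_boundP; rewrite divr_ge0 ?ltW.
have K2 : (K%:R : R) <= 2 ^+ K by rewrite -natrX ler_nat ltnW // ltn_expl.
rewrite expr_div_n expr1n mul1r ler_pdivlMr ?exprn_gt0 //.
rewrite ltr_pdivrMr // in MK.
have : K%:R * t <= 2 ^+ K * t by rewrite ler_wpM2r // ltW.
lra.
Qed.

(** Isolated zeros: f vanishes near p, or f = (z - p)^k g with g p nonzero, where k
    is the index of the first nonzero coefficient. *)
Lemma taylor_zero_order c f p : taylor_at c f p ->
  ((forall k, c k = 0) /\ \forall z \near p, f z = 0) \/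
  exists k g, [/\ c k != 0, forall j, (j < k)%N -> c j = 0, regular_at g p, g p = c k
    & forall z, f z = (z - p) ^+ k * g z].
Proof.
move=> H; have [[k ck]|nk] := pselect (exists k, c k != 0).
  right; have ex : exists k, c k != 0 by exists k.
  case: (ex_minnP ex) => {ck}k ck kmin.
  have c0 j : (j < k)%N -> c j = 0.
    by move=> jk; apply/eqP; apply: contraTT jk => /kmin; rewrite leqNgt.
  exists k; eexists; split; [exact: ck|exact: c0|eexists; exact: taylor_shift c0 H|..].
    by rewrite /= eqxx.
  move=> z /=; case: eqVneq => [->|zp]; last first.
    by rewrite mulrC divfK // expf_neq0 // subr_eq0.
  rewrite subrr (taylor_val H).
  case: k {ck kmin} c0 => [_|k c0]; first by rewrite expr0 mul1r.
  by rewrite c0 // expr0n mul0r.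
left; have c0 k : c k = 0.
  by apply/eqP; apply: contrapT => /negP ck; apply: nk; exists k.
split => //; have [M [k [e [M0 k0 e0 ke HH]]]] := taylor_nice H.
apply/nbhs_cabsP; exists e => // z ze.
apply/eqP; rewrite -cabs_eq0; apply/eqP/le_anti; rewrite cabs_ge0 andbT.
apply: (@le0_geometric _ M) => K.
have := HH z ze K; rewrite /taylor_sum big1 => [|i _]; last by rewrite c0 mul0r.
rewrite subr0 => h; apply: le_trans h _; rewrite ler_wpM2l ?(ltW M0) //.
have kz : 0 <= k * cabs (z - p) by rewrite mulr_ge0 ?cabs_ge0 ?ltW.
apply: lerXn2r; rewrite ?nnegrE //.
apply: le_trans ke; by rewrite ler_wpM2l // ltW.
Qed.

Lemma regular_zero_order f p : regular_at f p ->
  (\forall z \near p, f z = 0) \/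
  exists k g, [/\ regular_at g p, g p != 0 & forall z, f z = (z - p) ^+ k * g z].
Proof.
move=> [c H]; have [[_ ?]|[k [g [ck _ gA gp fE]]]] := taylor_zero_order H; first by left.
by right; exists k, g; split => //; rewrite gp.
Qed.

(** The divided difference (f z - f p) / (z - p) extends analytically to p. *)
Lemma regular_divdiff f p : regular_at f p ->
  exists g, regular_at g p /\ forall z, f z = f p + (z - p) * g z.
Proof.
move=> [c H]; have := taylor_sub H (taylor_cst (f p) p); set d := fun _ => _ => H2.
have d0 j : (j < 1)%N -> d j = 0.
  by case: j => // _; rewrite /d (taylor_val H) subrr.
eexists; split; first by eexists; exact: taylor_shift d0 H2.
move=> z /=; case: eqVneq => [->|zp].
  by rewrite subrr mul0r addr0.
by rewrite expr1 mulrC divfK ?subr_eq0 // addrC subrK.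
Qed.

(** No point of the complex plane is isolated. *)
Lemma exists_punctured p (P : Cplx R -> Prop) :
  (\forall z \near p, P z) -> exists2 z, z != p & P z.
Proof.
move=> /nbhs_cabsP[e e0 H]; have [z ze] := @exists_cabs R p (e / 2) (divr_gt0 e0 (ltr0Sn _ 1)).
exists z; last by apply: H; rewrite ze; lra.
by rewrite -subr_eq0 -cabs_gt0 ze divr_gt0.
Qed.

(** Analytic functions that agree in a deleted neighbourhood of p agree at p. *)
Lemma regular_eq f g p : regular_at f p -> regular_at g p ->
  (\forall z \near p, z != p -> f z = g z) -> f p = g p.
Proof.
move=> fA gA fg; apply/eqP; rewrite -subr_eq0; apply: contrapT => /negP nz.
have nz' := regular_neq0_near (regular_sub fA gA) nz.
have [z zp [e]] := exists_punctured (filterI fg nz').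
by rewrite e // subrr eqxx.
Qed.

Lemma cvg_cabsP (u : nat -> Cplx R) (l : Cplx R) :
  (u @ \oo --> l) <->
  forall e : R, 0 < e -> exists N, forall n, (N <= n)%N -> cabs (l - u n) < e.
Proof.
split.
  move=> /cvgrPdist_lt H e e0; have /H : 0 < (e%:C : Cplx R) by rewrite ltcR.
  move=> [N _ HN]; exists N => n Nn.
  by have := HN n Nn; rewrite /= normr_cabs ltcR.
move=> H; apply/cvgrPdist_lt => e e0.
have [er eE] : exists t : R, e = t%:C.
  by apply/complex_realP; exact: gtr0_real.
have [N HN] := H er (ltac:(by rewrite -ltcR -eE)).
by exists N => // n Nn; rewrite /= normr_cabs eE ltcR; exact: HN.
Qed.

Lemma series_taylor_sum c h n : series (fun k => c k * h ^+ k) n = taylor_sum c h n.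
Proof. by rewrite /series /taylor_sum /= big_mkord. Qed.

Lemma geometric_tail (t : R) K n : 0 <= t -> t <= 1 / 2 -> (K <= n)%N ->
  \sum_(K <= j < n) t ^+ j <= 2 * t ^+ K.
Proof.
move=> t0 t1 Kn.
suff : \sum_(K <= j < n) t ^+ j + 2 * t ^+ n <= 2 * t ^+ K.
  have : 0 <= t ^+ n by rewrite exprn_ge0.
  lra.
rewrite -(subnKC Kn); elim: (n - K)%N => [|m IH].
  by rewrite addn0 big_geq // add0r.
rewrite addnS big_nat_recr ?leq_addr //=; set S := \sum_(_ <= _ < _) _ in IH *.
have : 0 <= t ^+ (K + m) by rewrite exprn_ge0.
rewrite exprS; set u := t ^+ (K + m) in IH *; move=> u0.
have : t * u <= 1 / 2 * u by rewrite ler_wpM2r.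
lra.
Qed.

Lemma taylor_series c f p : taylor_at c f p ->
  \forall z \near p, series (fun k => c k * (z - p) ^+ k) @ \oo --> f z.
Proof.
move=> /taylor_nice[M [k [e [M0 k0 e0 ke H]]]].
apply/nbhs_cabsP; exists e => // z ze; apply/cvg_cabsP => r r0.
have [K HK] : exists K, M * (1 / 2) ^+ K < r.
  apply: contrapT => nK; have := @le0_geometric r M.
  rewrite leNgt r0 => H'; suff: false by []; apply: H' => K.
  by rewrite leNgt; apply/negP => h; apply: nK; exists K.
exists K => n Kn; rewrite series_taylor_sum.
apply: le_lt_trans (H z ze n) _; apply: le_lt_trans HK.
rewrite ler_wpM2l ?(ltW M0) //.
have kz : 0 <= k * cabs (z - p) by rewrite mulr_ge0 ?cabs_ge0 ?ltW.
apply: (@le_trans _ _ ((1 / 2) ^+ n)).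
  apply: lerXn2r; rewrite ?nnegrE //.
  by apply: le_trans ke; rewrite ler_wpM2l // ltW.
by apply: ler_wiXn2l => //; lra.
Qed.

Lemma series_taylor c f p :
  (\forall z \near p, series (fun k => c k * (z - p) ^+ k) @ \oo --> f z) ->
  taylor_at c f p.
Proof.
move=> /nbhs_cabsP[e e0 H].
have [z1 z1e] := @exists_cabs R p (e / 2) (divr_gt0 e0 (ltr0Sn _ 1)).
have := H z1; rewrite z1e => /(_ ltac:(lra))/cvg_cabsP/(_ 1 ltr01) [N HN].
set rho := e / 2 in z1e *; have rho0 : 0 < rho by rewrite divr_gt0.
(* The terms at z1 are bounded: by 2 beyond N, by the finite sum before. *)
pose B := 2 + \sum_(j < N) cabs (c j) * rho ^+ j.
have B0 : 0 < B.
  by rewrite ltr_pwDl // sumr_ge0 // => i _; rewrite mulr_ge0 ?cabs_ge0 // exprn_ge0 // ltW.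
have cb j : cabs (c j) * rho ^+ j <= B.
  have [Nj|jN] := leqP N j.
    rewrite -z1e -cabsX -cabsM.
    have h1 := HN j Nj; have h2 := HN j.+1 (leqW Nj).
    rewrite !series_taylor_sum taylor_sumS in h1 h2.
    set u := taylor_sum _ _ _ in h1 h2; set v := c j * _ in h2 *.
    have -> : v = (f z1 - u) - (f z1 - (u + v)) by ring.
    apply: le_trans (cabsD _ _) _; rewrite cabsN /B -addrA.
    have : 0 <= \sum_(j < N) cabs (c j) * rho ^+ j.
      by rewrite sumr_ge0 // => i _; rewrite mulr_ge0 ?cabs_ge0 // exprn_ge0 // ltW.
    lra.
  rewrite /B (bigD1 (Ordinal jN)) //= addrCA lerDl addr_ge0 // sumr_ge0 // => i _.
  by rewrite mulr_ge0 ?cabs_ge0 // exprn_ge0 // ltW.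
exists (2 * B), rho^-1, (Num.min e (rho / 2)); split.
- by rewrite mulr_ge0 // ltW.
- by rewrite invr_gt0.
- by rewrite lt_min e0 divr_gt0.
move=> z; rewrite lt_min => /andP[ze zr] K.
set t := rho^-1 * cabs (z - p).
have t0 : 0 <= t by rewrite mulr_ge0 ?cabs_ge0 // invr_ge0 ltW.
have t1 : t <= 1 / 2.
  by rewrite /t mulrC ler_pdivrMr // mulrC mulrA mulr1 ltW.
apply/ler_addgt0Pr => r r0.
have /cvg_cabsP/(_ r r0)[N' HN'] := H z ze.
pose n := maxn N' K.
have := HN' n (leq_maxl _ _); rewrite series_taylor_sum => h1.
have -> : f z - taylor_sum c (z - p) K =
   (f z - taylor_sum c (z - p) n) + (taylor_sum c (z - p) n - taylor_sum c (z - p) K) by ring.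
rewrite [X in _ <= X]addrC.
apply: le_trans (cabsD _ _) _; apply: lerD; first exact: ltW.
have pE m : taylor_sum c (z - p) m = \sum_(0 <= i < m) c i * (z - p) ^+ i.
  by rewrite /taylor_sum big_mkord.
have Kn : (K <= n)%N by exact: leq_maxr.
rewrite !pE (big_cat_nat (leq0n _) Kn) /= addrAC subrr add0r.
apply: le_trans (cabs_sum _ _ _) _.
apply: (@le_trans _ _ (\sum_(K <= i < n) B * t ^+ i)).
  apply: ler_sum => i _; rewrite cabsM cabsX /t exprMn mulrA ler_wpM2r ?exprn_ge0 ?cabs_ge0 //.
  by rewrite exprVn ler_pdivlMr ?exprn_gt0.
rewrite -mulr_sumr -mulrA mulrCA ler_wpM2l ?(ltW B0) //.
exact: geometric_tail.
Qed.

Lemma analytic_atP f p : analytic_at f p <-> regular_at f p.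
Proof.
split=> -[c H]; exists c; first exact: series_taylor.
exact: taylor_series.
Qed.

End Analytic.

(** * Identity theorem, minimum principle and boundary angles *)

Section HalfPlane.
Context {R : realType}.
Implicit Types (f g h : Cplx R -> Cplx R) (p z w : Cplx R).

Lemma open_upper : open (@upper_half_plane R).
Proof.
rewrite openE => p; rewrite /upper_half_plane /= => p0.
apply/nbhs_cabsP; exists (Imz p) => // w /= wp.
have := Im_le_cabs (p - w); rewrite ImD ImN cabsB => h1.
have := ler_norm (Imz p - Imz w); lra.
Qed.

Lemma open_near (P : Cplx R -> Prop) : open [set p : Cplx R | \forall z \near p, P z].
Proof. exact: (@open_interior _ P). Qed.

Lemma open_near_punctured (P : Cplx R -> Prop) :
  open [set p : Cplx R | \forall z \near p, z != p -> P z].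
Proof.
rewrite openE => p /= /nbhs_cabsP[e e0 H]; apply/nbhs_cabsP; exists e => // q qe /=.
have [->|qp] := eqVneq q p; first by apply/nbhs_cabsP; exists e.
apply/nbhs_cabsP; exists (Num.min (e - cabs (q - p)) (cabs (q - p))).
  by rewrite lt_min subr_gt0 qe cabs_gt0 subr_eq0.
move=> z; rewrite lt_min => /andP[z1 z2] _; apply: H.
  have -> : z - p = (z - q) + (q - p) by ring.
  by apply: le_lt_trans (cabsD _ _) _; rewrite -ltrBrDr.
by apply: contraTneq z2 => ->; rewrite cabsB ltxx.
Qed.

Lemma continuous_line p w : continuous (fun t : R => (p + t%:C * w : Cplx R)).
Proof.
move=> t; apply/cvgrPdist_lt => e e0.
have [er eE] : exists r : R, e = r%:C.
  by apply/complex_realP; exact: gtr0_real.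
have er0 : 0 < er by rewrite -ltcR -eE.
have w1 : 0 < cabs w + 1 by rewrite ltr_wpDl ?cabs_ge0.
near=> s; rewrite normr_cabs eE ltcR.
have -> : p + t%:C * w - (p + s%:C * w) = (t - s)%:C * w by rewrite rmorphB; ring.
rewrite cabsM cabs_real.
apply: (@le_lt_trans _ _ (`|t - s| * (cabs w + 1))); first by rewrite ler_wpM2l // lerDl.
rewrite -ltr_pdivlMr //.
near: s; exists (er / (cabs w + 1)) => /=; first exact: divr_gt0.
by [].
Unshelve. all: by end_near. Qed.

(** Identity theorem in the half-plane. Along the segment from z1 to z2, the points
    near which g is constantly w and the points p such that g avoids w near p, except
    perhaps at p, form a partition into two open sets, because zeros are isolated. *)
Lemma identity_theorem g w z1 : (forall z, upper_half_plane z -> regular_at g z) ->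
  upper_half_plane z1 -> (\forall z \near z1, g z = w) ->
  forall z, upper_half_plane z -> g z = w.
Proof.
move=> gA z1P gz1 z2 z2P.
have [<-|z12] := eqVneq z1 z2; first exact: nbhs_singleton gz1.
pose gam (t : R) : Cplx R := z1 + t%:C * (z2 - z1).
have gc : continuous gam by exact: continuous_line.
pose E := [set p : Cplx R | \forall z \near p, g z = w].
pose N := [set p : Cplx R | \forall z \near p, z != p -> g z != w].
have gamP t : t \in `[0, 1] -> upper_half_plane (gam t).
  rewrite in_itv /= => /andP[t0 t1]; move: z1P z2P; rewrite /upper_half_plane /=.
  rewrite /gam ImD ImM ImD ImN ReC ImC mul0r addr0 => a0 b0.
  have -> : Imz z1 + t * (Imz z2 - Imz z1) = (1 - t) * Imz z1 + t * Imz z2 by ring.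
  have [t1'|t1'] := ltP t 1.
    apply: ltr_pwDl; first by apply: mulr_gt0 => //; rewrite subr_gt0.
    by apply: mulr_ge0 => //; exact: ltW.
  apply: ltr_wpDl; first by rewrite mulr_ge0 ?(ltW a0) ?subr_ge0.
  by apply: mulr_gt0 => //; exact: lt_le_trans t1'.
have EN p : upper_half_plane p -> E p \/ N p.
  move=> pP; have [fl|[k [h [hA hp fE]]]] := regular_zero_order (regular_sub (gA p pP) (regular_cst w p)).
    by left; apply: filterS fl => z /eqP; rewrite subr_eq0 => /eqP.
  right; have := regular_neq0_near hA hp; apply: filterS => z hz zp.
  by rewrite -subr_eq0 fE mulf_neq0 // expf_neq0 // subr_eq0.
have ENF p : E p -> N p -> False.
  by move=> Ep Np; have [z zp [e n]] := exists_punctured (filterI Ep Np); move: (n zp); rewrite e eqxx.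
have Eo : open E by exact: open_near.
have No : open N by exact: open_near_punctured.
have Eg : open (gam @^-1` E) by apply: (open_comp _ Eo) => t _; exact: gc.
have Ng : open (gam @^-1` N) by apply: (open_comp _ No) => t _; exact: gc.
pose T := `[0, 1]%classic `&` (gam @^-1` E).
have TE : T = `[0, 1]%classic.
  apply: segment_connected.
  - exists 0; split; first by rewrite /= in_itv /= lexx ler01.
    rewrite /= /gam mul0r addr0; exact: gz1.
  - by exists (gam @^-1` E).
  - exists (~` (gam @^-1` N)).
      exact: open_closedC Ng.
    rewrite /T; apply/seteqP; split=> t [t01 H]; (split; first exact: t01).
      by move=> Nt; exact: (ENF _ H Nt).
    have [Et|Nt] := EN _ (gamP t t01); first exact: Et.
    by case: (H Nt).
have T1 : T 1 by rewrite TE /= in_itv /= lexx ler01.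
have /nbhs_singleton : E (gam 1) by case: T1.
by rewrite /gam mul1r addrC subrK.
Qed.

(** If Im (zeta h) is negative at p, it is negative at points p + t w arbitrarily
    close to p, whatever the direction w. *)
Lemma Im_neg_along h p w (zeta : Cplx R) : regular_at h p -> Imz (zeta * h p) < 0 ->
  forall e, 0 < e -> exists t : R, [/\ 0 < t, cabs (p + t%:C * w - p) < e &
    Imz (zeta * h (p + t%:C * w)) < 0].
Proof.
move=> hA neg e e0.
have /regular_near_val/(_ (- Imz (zeta * h p))) : regular_at (fun z => zeta * h z) p.
  by apply: regular_mul => //; exact: regular_cst.
rewrite oppr_gt0 => /(_ neg)/nbhs_cabsP[r r0 H].
have w1 : 0 < cabs w + 1 by rewrite ltr_wpDl ?cabs_ge0.
pose m := Num.min e r; have m0 : 0 < m by rewrite lt_min e0.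
pose t := m / 2 / (cabs w + 1).
have t0 : 0 < t by rewrite !divr_gt0.
have tm : cabs (p + t%:C * w - p) < m.
  rewrite addrAC subrr add0r cabsM cabs_real (gtr0_norm t0).
  apply: (@le_lt_trans _ _ (t * (cabs w + 1))).
    by rewrite ler_wpM2l ?(ltW t0) // lerDl.
  by rewrite divfK ?gt_eqF //; lra.
move: (tm); rewrite lt_min => /andP[te /H].
set u := _ * h _; set v := zeta * h p => uv.
exists t; split => //.
have := Im_le_cabs (u - v); rewrite ImD ImN => h1.
have := ler_norm (Imz u - Imz v); rewrite -/u; lra.
Qed.

Lemma exists_root k (c : Cplx R) : (0 < k)%N -> c != 0 ->
  exists w : Cplx R, Imz (w ^+ k * c) < 0.
Proof.
move=> k0 c0; exists (k.-root (- 'i%C / c)); rewrite rootCK // divfK //.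
by rewrite /= oppr_lt0 ltr01.
Qed.

(** For k >= 2 the argument of w^k sweeps more than a half-turn as w describes the
    upper half-plane, so w^k c can be given a negative imaginary part. *)
Lemma exists_root_upper k (c : Cplx R) : (2 <= k)%N -> c != 0 ->
  exists w : Cplx R, 0 < Imz w /\ Imz (w ^+ k * c) < 0.
Proof.
move=> k2 c0; have k0 : (0 < k)%N by exact: ltn_trans k2.
(* The k-th root of smallest argument is in the closed half-plane; it is not real
   unless its k-th power u is. *)
suff [u [uI uc]] : exists u : Cplx R, Imz u != 0 /\ Imz (u * c) < 0.
  exists (k.-root u); rewrite rootCK //; split => //.
  have := Im_rootC_ge0 u k2; rewrite -complexIm lecR le_eqVlt => /orP[/eqP/esym w0|//].
  case/negP: uI; rewrite -(rootCK k0 u).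
  have -> : k.-root u = (Rez (k.-root u))%:C :> Cplx R by apply: cplx_eq.
  by rewrite -rmorphXn.
(* -i / c and (1 - i) / c are not both real. *)
have [I0|I0] := eqVneq (Imz ((- 'i%C / c : Cplx R))) 0; last first.
  by exists (- 'i%C / c); rewrite divfK //=; split => //; lra.
exists ((1 - 'i%C) / c); rewrite divfK //; split; last by rewrite /=; lra.
apply/negP => /eqP I1.
have Ic : Imz c^-1 = 0.
  have : Imz ((1 - 'i%C) / c) = Imz (1 / c : Cplx R) + Imz (- 'i%C / c : Cplx R).
    by rewrite -ImD -mulrDl.
  by rewrite I1 I0 addr0 div1r.
have Rc : Rez c^-1 = 0.
  by move: I0; rewrite ImM Ic /=; lra.
by move: c0; rewrite -invr_eq0 => /eqP; apply; apply: cplx_eq.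
Qed.

(** Open mapping, for the imaginary part: Im g has no local minimum at p unless
    g is constant near p. *)
Lemma local_min g p : regular_at g p ->
  (\forall z \near p, Imz (g p) <= Imz (g z)) -> \forall z \near p, g z = g p.
Proof.
move=> gA /nbhs_cabsP[e e0 H].
have [fl|[k [h [hA hp fE]]]] := regular_zero_order (regular_sub gA (regular_cst (g p) p)).
  by apply: filterS fl => z /eqP; rewrite subr_eq0 => /eqP.
case: k fE => [|k] fE.
  by have := fE p; rewrite subrr expr0 mul1r => h0; move: hp; rewrite -h0 eqxx.
have [w wI] := exists_root (ltn0Sn k) hp.
have [t [t0 /H te tI]] := Im_neg_along w hA wI e0; move: te.
rewrite leNgt => /negP; case.
rewrite -subr_lt0 -ImN -ImD fE addrAC subrr add0r exprMn -mulrA -rmorphXn.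
by rewrite ImM ReC ImC mul0r addr0 pmulr_rlt0 // exprn_gt0.
Qed.

(** Minimum principle in the half-plane. The boundary condition, at infinity
    included, is that Im g can be below -eta only in a compact box of the open
    half-plane. *)
Lemma min_principle g : (forall z, upper_half_plane z -> regular_at g z) ->
  (forall eta : R, 0 < eta -> exists delta L : R, 0 < delta /\
     forall z, upper_half_plane z -> Imz (g z) < - eta ->
       [/\ delta <= Imz z, Imz z <= L & `|Rez z| <= L]) ->
  forall z, upper_half_plane z -> 0 <= Imz (g z).
Proof.
move=> gA bd z1 z1P; rewrite leNgt; apply/negP => g1.
(* The minimum over the box is below -eta, hence a minimum over the half-plane. *)
pose eta := - Imz (g z1) / 2.
have eta0 : 0 < eta by rewrite /eta; lra.
have [delta [L [d0 H]]] := bd eta eta0.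
have z1H : [/\ delta <= Imz z1, Imz z1 <= L & `|Rez z1| <= L].
  by apply: H => //; rewrite /eta; lra.
pose pt (u : R * R) : Cplx R := u.1 +i* u.2.
pose A : set (R * R) := `[- L, L]%classic `*` `[delta, L]%classic.
pose phi (u : R * R) := Imz (g (pt u)).
have Ain z : [/\ delta <= Imz z, Imz z <= L & `|Rez z| <= L] -> (Rez z, Imz z) \in A.
  move=> [a b c]; rewrite inE /A /=; split; rewrite /= in_itv /=.
    by rewrite -ler_norml.
  by rewrite a b.
have AP u : u \in A -> upper_half_plane (pt u).
  rewrite inE => -[_]; rewrite /= in_itv /= => /andP[du _].
  by rewrite /upper_half_plane /=; exact: lt_le_trans du.
have A0 : A !=set0 by exists (Rez z1, Imz z1); have := Ain _ z1H; rewrite inE.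
have Ac : compact A by apply: compact_setX; exact: segment_compact.
have phic : {within A, continuous phi}.
  apply: continuous_in_subspaceT => u /AP uP.
  apply/cvgrPdist_lt => e e0.
  have /nbhs_cabsP[r r0 Hr] := regular_near_val (gA _ uP) e0.
  have r2 : 0 < r / 2 by rewrite divr_gt0.
  have nb : nbhs u [set v : R * R | `|v.1 - u.1| < r / 2 /\ `|v.2 - u.2| < r / 2].
    exists ([set t | `|t - u.1| < r / 2], [set t | `|t - u.2| < r / 2]) => //.
    split; exists (r / 2) => //= t; by rewrite /= distrC.
  apply: filterS nb => v [v1 v2].
  have /Hr hr : cabs (pt v - pt u) < r.
    by apply: le_lt_trans (cabs_le _) _; rewrite /=; lra.
  apply: le_lt_trans hr; rewrite cabsB /phi -ImN -ImD; exact: Im_le_cabs.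
have [u uA umin] := compact_EVT_min A0 Ac phic.
have uP := AP u uA.
have u1 : phi u <= Imz (g z1).
  by have := umin _ (Ain _ z1H); rewrite /phi /pt /=; case: (z1).
have glob z : upper_half_plane z -> Imz (g (pt u)) <= Imz (g z).
  move=> zP; have [gz|gz] := ltP (Imz (g z)) (- eta).
    by have := umin _ (Ain _ (H z zP gz)); rewrite /phi /pt /=; case: (z).
  by apply: le_trans gz; rewrite /phi in u1; rewrite /eta; lra.
have lc : \forall z \near pt u, g z = g (pt u).
  apply: local_min; first exact: gA.
  by apply: filterS (open_nbhs_nbhs (conj open_upper uP)) => z; exact: glob.
have gc := identity_theorem gA uP lc.
(* g would be constant, but Im g >= -eta at z2, which is above the box. *)
pose z2 : Cplx R := 0 +i* (`|L| + 1).
have z2P : upper_half_plane z2.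
  by rewrite /upper_half_plane /= ltr_wpDl.
have [|_ h _] := H z2 z2P.
  by rewrite gc //; rewrite /phi in u1; rewrite /eta; lra.
by have := ler_norm L; rewrite /= in h; lra.
Qed.

(** A zero of order k >= 2 at a boundary point is incompatible with Im >= 0. *)
Lemma no_high_zero (h : Cplx R -> Cplx R) (x : R) k : (2 <= k)%N ->
  regular_at h x%:C -> h x%:C != 0 ->
  (\forall z \near (x%:C : Cplx R), upper_half_plane z -> 0 <= Imz ((z - x%:C) ^+ k * h z)) ->
  False.
Proof.
move=> k2 hA hx /nbhs_cabsP[e e0 H].
have [w [w0 wI]] := exists_root_upper k2 hx.
have [t [t0 /H te tI]] := Im_neg_along w hA wI e0; move: te.
move=> /(_ _); rewrite /upper_half_plane /= leNgt => /(_ _)/negP; apply.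
  by rewrite ImD ImM ReC !ImC mul0r addr0 add0r mulr_gt0.
rewrite addrAC subrr add0r exprMn -mulrA -rmorphXn.
by rewrite ImM ReC ImC mul0r addr0 pmulr_rlt0 // exprn_gt0.
Qed.

(** Likewise for a pole of order k >= 2. *)
Lemma no_high_pole (h : Cplx R -> Cplx R) (x : R) k : (2 <= k)%N ->
  regular_at h x%:C -> h x%:C != 0 ->
  (\forall z \near (x%:C : Cplx R), upper_half_plane z -> 0 <= Imz (h z / (z - x%:C) ^+ k)) ->
  False.
Proof.
move=> k2 hA hx /nbhs_cabsP[e e0 H].
have hc : - (h x%:C)^-1 != 0 by rewrite oppr_eq0 invr_eq0.
have [w [w0 wI]] := exists_root_upper k2 hc.
have wn : w != 0 by apply: contraTneq w0 => ->; rewrite ltxx.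
have wI' : Imz ((w ^+ k)^-1 * h x%:C) < 0.
  set u := w ^+ k * - (h x%:C)^-1 in wI.
  have -> : (w ^+ k)^-1 * h x%:C = - u^-1.
    by rewrite /u mulrN invrN invfM invrK opprK.
  rewrite ImN ImV mulNr opprK pmulr_llt0 // invr_gt0 exprn_gt0 // cabs_gt0.
  by rewrite /u mulf_neq0 // expf_neq0.
have [t [t0 /H te tI]] := Im_neg_along w hA wI' e0; move: te.
move=> /(_ _); rewrite /upper_half_plane /= leNgt => /(_ _)/negP; apply.
  by rewrite ImD ImM ReC !ImC mul0r addr0 add0r mulr_gt0.
rewrite addrAC subrr add0r exprMn invfM mulrC -mulrA -rmorphXn -fmorphV.
by rewrite ImM ReC ImC mul0r addr0 pmulr_rlt0 // invr_gt0 exprn_gt0.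
Qed.

End HalfPlane.

(** * Rigidity at a boundary point *)

(** Pick functions that are analytic at the real point x, in a full neighbourhood. *)
Definition Pick_regular_at (R : realType) (x : R) (f : Cplx R -> Cplx R) : Prop :=
  [/\ forall z, upper_half_plane z -> regular_at f z, regular_at f x%:C
    & forall z, upper_half_plane z -> 0 <= Imz (f z)].

(** A real polynomial, as a complex one. *)
Definition cpoly (R : realType) (P : {poly R}) : {poly Cplx R} :=
  map_poly (real_complex R) P.

Section Uniqueness.
Context {R : realType}.
Implicit Types (f g h F q : Cplx R -> Cplx R) (x : R) (z w : Cplx R).

Lemma upper_neq_real x z : upper_half_plane z -> z - x%:C != 0.
Proof.
rewrite /upper_half_plane /= => z0; apply: contraTneq z0 => /eqP.
by rewrite subr_eq0 => /eqP ->; rewrite ImC ltxx.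
Qed.

Lemma exists_upper_near x (P : Cplx R -> Prop) :
  (\forall z \near (x%:C : Cplx R), P z) -> exists2 z, upper_half_plane z & P z.
Proof.
move=> /nbhs_cabsP[e e0 H]; have e2 : 0 < e / 2 by rewrite divr_gt0.
exists (x%:C + (0 +i* (e / 2))); first by rewrite /upper_half_plane /= add0r.
apply: H; rewrite addrAC subrr add0r.
by apply: le_lt_trans (cabs_le _) _; rewrite /= normr0 add0r gtr0_norm //; lra.
Qed.

(** If phi has nonnegative imaginary part and the sum of phi and b / (z - x), b >= 0,
    is analytic at x with Im >= 0 there, then that sum is a Pick function: the
    imaginary part of b / (z - x) tends to 0 at all boundary points other than x, and
    at infinity. *)
Lemma pole_removal x (b : R) (phi g : Cplx R -> Cplx R) : 0 <= b ->
  (forall z, upper_half_plane z -> 0 <= Imz (phi z)) ->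
  (forall z, upper_half_plane z -> g z = phi z + b%:C / (z - x%:C)) ->
  (forall z, upper_half_plane z -> regular_at g z) -> regular_at g x%:C -> 0 <= Imz (g x%:C) ->
  forall z, upper_half_plane z -> 0 <= Imz (g z).
Proof.
move=> b0 phiP gE gA gx gx0; apply: min_principle => // eta eta0.
have /nbhs_cabsP[rho rho0 Hr] := regular_near_val gx eta0.
have b1 : 0 < b + 1 by rewrite ltr_wpDl.
exists (eta * rho ^+ 2 / (b + 1)), (`|x| + b / eta); split.
  by rewrite divr_gt0 // mulr_gt0 // exprn_gt0.
move=> z zP gz; set s := z - x%:C.
have sI : Imz s = Imz z by rewrite /s ImD ImN ImC subr0.
have s0 : 0 < cabs s by rewrite cabs_gt0 upper_neq_real.
have zs : Imz z <= cabs s by rewrite -sI; apply: le_trans (Im_le_cabs _); exact: ler_norm.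
have rs : rho <= cabs s.
  rewrite leNgt; apply/negP => /Hr h.
  have := Im_le_cabs (g z - g x%:C); rewrite ImD ImN => h1.
  have := ler_norm (- (Imz (g z) - Imz (g x%:C))); rewrite normrN; lra.
have by_ : eta * cabs s ^+ 2 < b * Imz z.
  have := phiP z zP; have := gz; rewrite gE // ImD ImM ImV ReC ImC mul0r addr0.
  rewrite -/s sI mulNr mulrN => h1 h2.
  have : eta < b * (Imz z / cabs s ^+ 2) by lra.
  by rewrite mulrA ltr_pdivlMr // exprn_gt0.
have zP' : 0 < Imz z by [].
have sb : cabs s <= b / eta.
  rewrite ler_pdivlMr //.
  have : b * Imz z <= b * cabs s by rewrite ler_wpM2l.
  move=> h; have : eta * cabs s * cabs s < b * cabs s by rewrite -mulrA -expr2; lra.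
  by rewrite ltr_pM2r // mulrC => /ltW.
split.
- rewrite ler_pdivrMr //.
  have : eta * rho ^+ 2 <= eta * cabs s ^+ 2.
    rewrite ler_wpM2l ?(ltW eta0) //; apply: lerXn2r => //; rewrite nnegrE ?cabs_ge0 //.
    exact: ltW.
  nra.
- have := normr_ge0 x; lra.
- have -> : Rez z = x + Rez s by rewrite /s ReD ReN ReC; ring.
  apply: le_trans (ler_normD _ _) _; rewrite lerD2l.
  exact: le_trans (Re_le_cabs _) sb.
Qed.

(** Boundary rigidity in degree 0: a Pick function with a real value and no first
    order term at x is constant. *)
Lemma flat_constant x f g (a0 : R) : Pick_regular_at x f ->
  (forall z, f z = a0%:C + (z - x%:C) ^+ 2 * g z) -> regular_at g x%:C ->
  forall z, upper_half_plane z -> f z = a0%:C.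
Proof.
move=> [fA fx fP] fE gA.
have [fl|[k [h [hA hx hE]]]] := regular_zero_order (regular_sub fx (regular_cst a0%:C x%:C)).
  have [z1 z1P fz1] := exists_upper_near (nbhs_interior fl).
  apply: (identity_theorem fA z1P).
  by apply: filterS fz1 => z /eqP; rewrite subr_eq0 => /eqP.
exfalso; case: k hE => [|[|k]] hE.
- have := hE x%:C; rewrite fE subrr expr0 mul1r expr0n mul0r addr0 subrr => h0.
  by move: hx; rewrite -h0 eqxx.
- have : h x%:C = (x%:C - x%:C) * g x%:C.
    apply: (regular_eq hA (g := fun z => (z - x%:C) * g z)).
      by apply: regular_mul => //; exact: regular_id.
    near=> z => zx; have := hE z; rewrite fE expr1 addrAC subrr add0r expr2 -mulrA.
    by move/mulfI => -> //; rewrite subr_eq0.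
  by rewrite subrr mul0r => h0; move: hx; rewrite h0 eqxx.
- apply: (no_high_zero (k := k.+2) _ hA hx) => //; near=> z => zP.
  by rewrite -hE ImD ImN ImC subr0 fP.
Unshelve. all: by end_near. Qed.

(** Away from x, a divided difference at x is analytic wherever f is. *)
Lemma regular_quotient f q x (a : Cplx R) z : upper_half_plane z ->
  (forall z, f z = a + (z - x%:C) * q z) -> regular_at f z -> regular_at q z.
Proof.
move=> zP fE fA.
have : regular_at (fun w => (f w - a) / (w - x%:C)) z.
  apply: regular_div; [|exact: regular_id|exact: upper_neq_real].
  by apply: regular_sub => //; exact: regular_cst.
apply: regular_near.
have := regular_neq0_near (regular_id z x%:C) (upper_neq_real x zP).
apply: filterS => w w0; rewrite fE addrAC subrr add0r mulrC mulKf //.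
Qed.

(** Boundary Schur reduction. With s = z - x and f = a0 + a1 s + a2 s^2 + ..., the
    function q2 / (a1 q) is -1 / (f - a0) + 1 / (a1 s): the pole of -1 / (f - a0) at x
    is cancelled, the value at x is the real number a2 / a1^2, and [pole_removal]
    applies. *)
Lemma julia_step x f q q2 (a0 a1 a2 : R) : Pick_regular_at x f ->
  regular_at q x%:C -> regular_at q2 x%:C ->
  (forall z, f z = a0%:C + (z - x%:C) * q z) ->
  (forall z, q z = a1%:C + (z - x%:C) * q2 z) ->
  0 < a1 -> q2 x%:C = a2%:C ->
  (forall z, upper_half_plane z -> q z != 0) /\
  Pick_regular_at x (fun z => q2 z / (a1%:C * q z)).
Proof.
move=> [fA fx fP] qA q2A fE qE a10 q2x.
have qx : q x%:C = a1%:C by rewrite qE subrr mul0r addr0.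
have a1n : a1%:C != 0 :> Cplx R by rewrite -cabs_eq0 cabs_real normr_eq0 gt_eqF.
have qn z : upper_half_plane z -> q z != 0.
  move=> zP; apply/negP => /eqP q0.
  have fz : f z = a0%:C by rewrite fE q0 mulr0 addr0.
  have lc : \forall w \near z, f w = f z.
    apply: local_min; first exact: fA.
    apply: filterS (open_nbhs_nbhs (conj open_upper zP)) => w wP.
    by rewrite fz ImC fP.
  have fc := identity_theorem fA zP lc.
  have qx0 : q x%:C != 0 by rewrite qx.
  have [w wP] := exists_upper_near (regular_neq0_near qA qx0).
  have := fc w wP; rewrite fz fE => /eqP; rewrite -subr_eq0 addrAC subrr add0r.
  by rewrite mulf_eq0 (negPf (upper_neq_real x wP)) /= => /eqP ->; rewrite eqxx.
split => //.
have qAP z : upper_half_plane z -> regular_at q z by move=> zP; exact: (regular_quotient zP fE (fA z zP)).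
have q2AP z : upper_half_plane z -> regular_at q2 z.
  by move=> zP; exact: (regular_quotient zP qE (qAP z zP)).
have psiA z : upper_half_plane z -> regular_at (fun z => q2 z / (a1%:C * q z)) z.
  move=> zP; apply: regular_div; [exact: q2AP| |by rewrite mulf_neq0 ?qn].
  by apply: regular_mul; [exact: regular_cst|exact: qAP].
have psix : regular_at (fun z => q2 z / (a1%:C * q z)) x%:C.
  apply: regular_div => //; last by rewrite mulf_neq0 ?qx.
  by apply: regular_mul => //; exact: regular_cst.
split => //.
apply: (@pole_removal x a1^-1 (fun z => - (f z - a0%:C)^-1)) => //.
- by rewrite invr_ge0 ltW.
- move=> z zP; rewrite ImN ImV mulNr opprK ImD ImN ImC subr0.
  by rewrite divr_ge0 ?fP // exprn_ge0 // cabs_ge0.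
- move=> z zP; rewrite fE qE fmorphV.
  have s0 := upper_neq_real x zP; have := qn z zP; rewrite qE => q0.
  rewrite (addrAC a0%:C) subrr add0r.
  by field; rewrite s0 a1n q0.
- by rewrite q2x qx -rmorphM -fmorphV -rmorphM ImC.
Qed.

Lemma cpoly0 (P : {poly R}) : (cpoly P).[0] = (P.[0])%:C.
Proof. by rewrite /cpoly -[0 in LHS](rmorph0 (real_complex R)) horner_map. Qed.

Lemma poly_divX (P : {poly R}) : P.[0] = 0 ->
  exists P1, P = P1 * 'X /\ size P1 = (size P).-1.
Proof.
move=> P0; have /factor_theorem[P1 PE] : root P 0 by apply/rootP.
rewrite subr0 in PE; exists P1; split => //.
have [P10|n0] := eqVneq P1 0; last by rewrite PE size_mulX.
by rewrite PE P10 mul0r size_poly0.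
Qed.

(** The divided difference at x of the rational function N / Q is N1 / Q, where
    N - a Q = X N1; polynomials are in the variable z - x. *)
Lemma rational_divdiff x (N Q N1 : {poly R}) F q (a : R) :
  N - a *: Q = N1 * 'X -> regular_at q x%:C ->
  (forall z, F z = a%:C + (z - x%:C) * q z) ->
  (forall z, upper_half_plane z -> (cpoly Q).[z - x%:C] * F z = (cpoly N).[z - x%:C]) ->
  (\forall z \near (x%:C : Cplx R), (cpoly Q).[z - x%:C] * F z = (cpoly N).[z - x%:C]) ->
  (forall z, upper_half_plane z -> (cpoly Q).[z - x%:C] * q z = (cpoly N1).[z - x%:C]) /\
  (\forall z \near (x%:C : Cplx R), (cpoly Q).[z - x%:C] * q z = (cpoly N1).[z - x%:C]).
Proof.
move=> NE qA FE FP Fx.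
have key z : z - x%:C != 0 -> (cpoly Q).[z - x%:C] * F z = (cpoly N).[z - x%:C] ->
   (cpoly Q).[z - x%:C] * q z = (cpoly N1).[z - x%:C].
  move=> s0 QF; apply: (mulIf s0).
  have := congr1 (fun P => (cpoly P).[z - x%:C]) NE.
  rewrite /cpoly rmorphB rmorphM /= linearZ /= map_polyX !hornerE -/(cpoly _) -/(cpoly _).
  by move <-; rewrite -QF FE; ring.
split; first by move=> z zP; apply: key; [exact: upper_neq_real|exact: FP].
have nx : \forall z \near (x%:C : Cplx R), z != x%:C ->
    (cpoly Q).[z - x%:C] * q z = (cpoly N1).[z - x%:C].
  by apply: filterS Fx => z QF zx; apply: key => //; rewrite subr_eq0.
have xx : (cpoly Q).[x%:C - x%:C] * q x%:C = (cpoly N1).[x%:C - x%:C].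
  apply: (regular_eq (f := fun z => (cpoly Q).[z - x%:C] * q z)
    (g := fun z => (cpoly N1).[z - x%:C])) nx.
    by apply: regular_mul => //; exact: regular_horner.
  exact: regular_horner.
apply: filterS nx => z; have [-> //|zx h] := eqVneq z x%:C; exact: h.
Qed.

(** Taking divided differences lowers the order of agreement by one. *)
Lemma agree_divdiff x f F qf qF e k (a : Cplx R) :
  regular_at qf x%:C -> regular_at qF x%:C -> regular_at e x%:C ->
  (forall z, f z = a + (z - x%:C) * qf z) ->
  (forall z, F z = a + (z - x%:C) * qF z) ->
  (\forall z \near (x%:C : Cplx R), f z = F z + (z - x%:C) ^+ k.+1 * e z) ->
  \forall z \near (x%:C : Cplx R), qf z = qF z + (z - x%:C) ^+ k * e z.
Proof.
move=> qfA qFA eA fE FE fF.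
have nx : \forall z \near (x%:C : Cplx R), z != x%:C ->
    qf z = qF z + (z - x%:C) ^+ k * e z.
  apply: filterS fF => z; rewrite fE FE exprS => h zx.
  have s0 : z - x%:C != 0 by rewrite subr_eq0.
  apply: (mulfI s0); apply: (addrI a); rewrite h; ring.
have xx : qf x%:C = qF x%:C + (x%:C - x%:C) ^+ k * e x%:C.
  apply: (regular_eq (g := fun z => qF z + (z - x%:C) ^+ k * e z)) nx => //.
  apply: regular_add => //; apply: regular_mul => //.
  apply: regular_near (regular_horner 'X^k x%:C x%:C); near=> z; by rewrite hornerXn.
apply: filterS nx => z; have [-> //|zx h] := eqVneq z x%:C; exact: h.
Unshelve. all: by end_near. Qed.

(** Julia: the first order coefficient of a Pick function at x is nonnegative; it is
    enough to approach x vertically. *)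
Lemma slope_ge0 x f q (a0 a1 : R) : Pick_regular_at x f -> regular_at q x%:C ->
  (forall z, f z = a0%:C + (z - x%:C) * q z) -> q x%:C = a1%:C -> 0 <= a1.
Proof.
move=> [_ _ fP] qA fE qx; rewrite leNgt; apply/negP => a10.
have neg : Imz ('i%C * q x%:C) < 0 by rewrite qx ImM /= mul0r add0r mul1r.
have [t [t0 _ tI]] := Im_neg_along ('i%C : Cplx R) qA neg ltr01.
have zP : upper_half_plane (x%:C + t%:C * 'i%C : Cplx R).
  by rewrite /upper_half_plane /= mulr1 mul0r addr0 add0r.
have := fP _ zP; rewrite fE (addrAC x%:C) subrr add0r -mulrA.
rewrite ImD ImC add0r ImM ReC ImC mul0r addr0 => h.
have : t * Imz ('i%C * q (x%:C + t%:C * 'i%C)) < 0 by rewrite pmulr_rlt0.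
lra.
Qed.

(** A Pick function f that agrees to order 2 r with a rational Pick function F
    = N / Q, where N and Q are real polynomials of degree less than r, is equal to F.
    If F has zero slope at x, both are constant by [flat_constant]; otherwise
    [julia_step] turns N / Q into N2 / (a1 N1), lowers the degree bound by one and the
    order of agreement by two. *)
Lemma rigidity r : forall x (N Q : {poly R}) F f,
  (size N <= r)%N -> (size Q <= r)%N -> Q.[0] != 0 ->
  Pick_regular_at x F -> Pick_regular_at x f ->
  (forall z, upper_half_plane z -> (cpoly Q).[z - x%:C] * F z = (cpoly N).[z - x%:C]) ->
  (\forall z \near (x%:C : Cplx R), (cpoly Q).[z - x%:C] * F z = (cpoly N).[z - x%:C]) ->
  (exists2 e, regular_at e x%:C &
    \forall z \near (x%:C : Cplx R), f z = F z + (z - x%:C) ^+ (r.*2) * e z) ->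
  forall z, upper_half_plane z -> f z = F z.
Proof.
elim: r => [|r IH] x N Q F f sN sQ Q0 FP fP FQ FQx [e eA ef].
  by move: sQ Q0; rewrite leqn0 size_poly_eq0 => /eqP ->; rewrite horner0 eqxx.
have [_ FA _] := FP; have [_ fA _] := fP; rewrite doubleS in ef.
have Q0c : (cpoly Q).[x%:C - x%:C] != 0.
  by rewrite subrr cpoly0 -cabs_eq0 cabs_real normr_eq0.
(* The three leading coefficients a0, a1, a2 of F are real, and f has the same. *)
pose a0 := N.[0] / Q.[0].
have Fx : F x%:C = a0%:C.
  have := nbhs_singleton FQx => h; apply: (mulfI Q0c); rewrite h subrr !cpoly0.
  by rewrite /a0 -rmorphM mulrC divfK.
have fx : f x%:C = a0%:C.
  by have := nbhs_singleton ef; rewrite subrr expr0n mul0r addr0 Fx.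
have [N1 [N1E sN1]] : exists N1, N - a0 *: Q = N1 * 'X /\ size N1 = (size (N - a0 *: Q)).-1.
  by apply: poly_divX; rewrite !hornerE /a0 divfK // subrr.
have sN1r : (size N1 <= r)%N.
  rewrite sN1 -ltnS; apply: (@leq_trans (size (N - a0 *: Q)).-1.+1) => //.
  rewrite ltnS -subn1 leq_subLR add1n; apply: leq_trans (size_polyD _ _) _.
  by rewrite geq_max sN size_polyN (leq_trans (size_scale_leq _ _)).
have [qF [qFA FE]] := regular_divdiff FA; rewrite Fx in FE.
have [qf [qfA fE]] := regular_divdiff fA; rewrite fx in fE.
have [qFP qFx] := rational_divdiff N1E qFA FE FQ FQx.
have qag := agree_divdiff qfA qFA eA fE FE ef.
have qfx : qf x%:C = qF x%:C.
  by have := nbhs_singleton qag; rewrite subrr expr0n mul0r addr0.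
pose a1 := N1.[0] / Q.[0].
have qFa1 : qF x%:C = a1%:C.
  have := nbhs_singleton qFx => h; apply: (mulfI Q0c); rewrite h subrr !cpoly0.
  by rewrite /a1 -rmorphM mulrC divfK.
have [q2F [q2FA qFE]] := regular_divdiff qFA; rewrite qFa1 in qFE.
have [q2f [q2fA qfE]] := regular_divdiff qfA; rewrite qfx qFa1 in qfE.
have a1ge : 0 <= a1 by exact: slope_ge0 FP qFA FE qFa1.
have [a1z|a1n] := eqVneq a1 0.
  move=> z zP.
  rewrite (@flat_constant x f q2f a0 fP _ q2fA z zP); last first.
    by move=> w; rewrite fE qfE a1z add0r mulrA -expr2.
  rewrite (@flat_constant x F q2F a0 FP _ q2FA z zP) //.
  by move=> w; rewrite FE qFE a1z add0r mulrA -expr2.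
have a1gt : 0 < a1 by rewrite lt_def a1n a1ge.
have a1c : a1%:C != 0 :> Cplx R by rewrite -cabs_eq0 cabs_real normr_eq0.
have [N2 [N2E sN2]] : exists N2, N1 - a1 *: Q = N2 * 'X /\ size N2 = (size (N1 - a1 *: Q)).-1.
  by apply: poly_divX; rewrite !hornerE /a1 divfK // subrr.
have sN2r : (size N2 <= r)%N.
  rewrite sN2 -subn1 leq_subLR add1n; apply: leq_trans (size_polyD _ _) _.
  by rewrite geq_max (leqW sN1r) size_polyN (leq_trans (size_scale_leq _ _)).
have [q2FP q2Fx] := rational_divdiff N2E q2FA qFE qFP qFx.
have q2ag := agree_divdiff q2fA q2FA eA qfE qFE qag.
pose a2 := N2.[0] / Q.[0].
have q2Fa2 : q2F x%:C = a2%:C.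
  have := nbhs_singleton q2Fx => h; apply: (mulfI Q0c); rewrite h subrr !cpoly0.
  by rewrite /a2 -rmorphM mulrC divfK.
have r0 : (0 < r)%N.
  rewrite lt0n; apply: contra_neq a1n => r0; move: sN1r.
  by rewrite r0 leqn0 size_poly_eq0 /a1 => /eqP ->; rewrite horner0 mul0r.
have q2fa2 : q2f x%:C = a2%:C.
  have := nbhs_singleton q2ag; rewrite subrr expr0n double_eq0 (gtn_eqF r0).
  by rewrite mul0r addr0 q2Fa2.
have [qFn psiF] := julia_step FP qFA q2FA FE qFE a1gt q2Fa2.
have [qfn psif] := julia_step fP qfA q2fA fE qfE a1gt q2fa2.
have qFx0 : qF x%:C != 0 by rewrite qFa1.
have qfx0 : qf x%:C != 0 by rewrite qfx.
have cE z : (cpoly (a1 *: N1)).[z] = a1%:C * (cpoly N1).[z].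
  by rewrite /cpoly linearZ /= hornerZ.
have psi_eq := IH x N2 (a1 *: N1) _ _ sN2r _ _ psiF psif.
have psi z : upper_half_plane z -> q2f z / (a1%:C * qf z) = q2F z / (a1%:C * qF z).
  apply: psi_eq.
  - exact: leq_trans (size_scale_leq _ _) sN1r.
  - rewrite hornerZ mulf_neq0 //; apply: contra_neq a1n => h.
    by rewrite /a1 h mul0r.
  - move=> w wP; rewrite cE -qFP // -q2FP //.
    by have := qFn w wP => qn; field; rewrite qn a1c.
  - apply: filterS3 qFx q2Fx (regular_neq0_near qFA qFx0) => w h1 h2 qn.
    by rewrite cE -h1 -h2; field; rewrite qn a1c.
  - exists (fun w => e w / (qf w * qF w)).
      by apply: regular_div => //; [exact: regular_mul|exact: mulf_neq0].
    apply: filterS3 q2ag (regular_neq0_near qFA qFx0) (regular_neq0_near qfA qfx0).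
    move=> w h1 qFw qfw.
    have : q2f w * qF w - q2F w * qf w = a1%:C * (w - x%:C) ^+ r.*2 * e w.
      rewrite (qfE w) h1.
      have -> : q2F w * (a1%:C + (w - x%:C) * (q2F w + (w - x%:C) ^+ r.*2 * e w)) =
        q2F w * (qF w + (w - x%:C) * ((w - x%:C) ^+ r.*2 * e w)).
        by rewrite (qFE w); ring.
      by rewrite (qFE w); ring.
    move=> h; apply/eqP; rewrite -subr_eq0; apply/eqP.
    have -> : q2f w / (a1%:C * qf w) -
      (q2F w / (a1%:C * qF w) + (w - x%:C) ^+ r.*2 * (e w / (qf w * qF w))) =
      (q2f w * qF w - q2F w * qf w - a1%:C * (w - x%:C) ^+ r.*2 * e w) /
        (a1%:C * qf w * qF w).
      by field; rewrite qFw qfw a1c.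
    by rewrite h subrr mul0r.
move=> z zP; rewrite fE FE; congr (_ + _ * _).
have s0 := upper_neq_real x zP.
have qn := qfn z zP; have Qn := qFn z zP.
have : q2f z * qF z = q2F z * qf z.
  have := psi z zP => h.
  have -> : q2f z = q2f z / (a1%:C * qf z) * (a1%:C * qf z) by rewrite divfK // mulf_neq0.
  by rewrite h; field; rewrite a1c Qn.
move=> h; apply: (mulfI a1c); apply/eqP; rewrite -subr_eq0; apply/eqP.
have -> : a1%:C * qf z - a1%:C * qF z =
   (z - x%:C) * (q2f z * qF z - q2F z * qf z) -
   ((a1%:C + (z - x%:C) * q2f z) - qf z) * qF z + ((a1%:C + (z - x%:C) * q2F z) - qF z) * qf z.
  ring.
by rewrite -qfE -qFE !subrr !mul0r h subrr mulr0 subr0 addr0.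
Qed.

End Uniqueness.

(** * Positive forms and kernels of Hankel matrices *)

Section PositiveForms.
Context {R : realType}.

(** The bilinear form of the matrix A. *)
Definition bform m (A : 'M[R]_m) (v w : 'cV[R]_m) : R := (v^T *m A *m w) ord0 ord0.

Lemma bformDl m (A : 'M[R]_m) v v' w : bform A (v + v') w = bform A v w + bform A v' w.
Proof. by rewrite /bform linearD /= !mulmxDl mxE. Qed.

Lemma bformDr m (A : 'M[R]_m) v w w' : bform A v (w + w') = bform A v w + bform A v w'.
Proof. by rewrite /bform mulmxDr mxE. Qed.

Lemma bformZl m (A : 'M[R]_m) t v w : bform A (t *: v) w = t * bform A v w.
Proof. by rewrite /bform linearZ /= -!scalemxAl mxE. Qed.

Lemma bformZr m (A : 'M[R]_m) t v w : bform A v (t *: w) = t * bform A v w.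
Proof. by rewrite /bform -scalemxAr mxE. Qed.

Lemma bformC m (A : 'M[R]_m) v w : A^T = A -> bform A v w = bform A w v.
Proof.
move=> AT; rewrite /bform.
have -> : v^T *m A *m w = (w^T *m A *m v)^T by rewrite !trmx_mul trmxK AT mulmxA.
by rewrite mxE.
Qed.

Lemma bform_sum m (A : 'M[R]_m) (v w : 'cV[R]_m) :
  bform A v w = \sum_(i < m) \sum_(j < m) v i ord0 * A i j * w j ord0.
Proof.
rewrite /bform mxE exchange_big /=; apply: eq_bigr => j _.
by rewrite mxE mulr_suml; apply: eq_bigr => i _; rewrite mxE.
Qed.

Lemma psd_cauchy_schwarz m (A : 'M[R]_m) v w : psd A ->
  bform A v w ^+ 2 <= bform A v v * bform A w w.
Proof.
move=> [AT A0].
have H s t : 0 <= s ^+ 2 * bform A v v + 2 * s * t * bform A v w + t ^+ 2 * bform A w w.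
  have := A0 (s *: v + t *: w); rewrite -/(bform _ _ _).
  rewrite !(bformDl, bformDr, bformZl, bformZr) (bformC w v AT) => h.
  by apply: le_trans h _; rewrite le_eqVlt; apply/orP; left; apply/eqP; ring.
have vv : 0 <= bform A v v by exact: A0.
have := A0 w; rewrite -/(bform _ _ _) le_eqVlt => /orP[/eqP ww|ww].
  rewrite -ww mulr0 in H *; have [->|nz] := eqVneq (bform A v w) 0; first by rewrite expr0n.
  (* If w is isotropic the form is affine along w, and is -1 for this multiple of w. *)
  have := H 1 (- (bform A v v + 1) / (2 * bform A v w)).
  have -> : 1 ^+ 2 * bform A v v + 2 * 1 * (- (bform A v v + 1) / (2 * bform A v w)) *
     bform A v w + (- (bform A v v + 1) / (2 * bform A v w)) ^+ 2 * 0 = -1.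
    by field.
  lra.
have := H (bform A w w) (- bform A v w).
set x := bform A v w; set y := bform A v v in vv *; set z := bform A w w in ww *.
have -> : z ^+ 2 * y + 2 * z * - x * x + (- x) ^+ 2 * z = z * (y * z - x ^+ 2) by ring.
by rewrite pmulr_rge0 // subr_ge0.
Qed.

Lemma psd_ker m (A : 'M[R]_m) v : psd A -> bform A v v = 0 -> A *m v = 0.
Proof.
move=> Apsd v0; apply/colP => i; rewrite [RHS]mxE.
have := psd_cauchy_schwarz (delta_mx i ord0) v Apsd.
rewrite v0 mulr0 => h.
have : bform A (delta_mx i ord0) v = 0.
  by apply/eqP; rewrite -sqrf_eq0 eq_le h sqr_ge0.
by rewrite /bform trmx_delta -mulmxA -rowE mxE.
Qed.

(** SE-minimality gives a kernel vector with nonzero last entry. Otherwise the last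
    basis vector is w A for some w, and by Cauchy-Schwarz A dominates
    diag(0, ..., 0, 1 / w_max). *)
Lemma SE_minimal_ker m (A : 'M[R]_m.+1) : SE_minimally_positive A ->
  exists u : 'cV[R]_m.+1, A *m u = 0 /\ u ord_max ord0 != 0.
Proof.
move=> [Apsd Amin]; have [AT A0] := Apsd.
have [/submxP[w wE]|] := boolP ((delta_mx ord0 ord_max : 'rV[R]_m.+1) <= A)%MS.
  exfalso.
  have Bw v : bform A w^T v = v ord_max ord0.
    by rewrite /bform trmxK -wE -rowE mxE.
  have CS (v : 'cV[R]_m.+1) : v ord_max ord0 ^+ 2 <= bform A v v * w ord0 ord_max.
    have := psd_cauchy_schwarz w^T v Apsd; rewrite !Bw mxE mulrC; exact.
  have w0 : 0 < w ord0 ord_max.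
    have := CS (delta_mx ord_max ord0); rewrite mxE !eqxx expr1n => h.
    have := A0 w^T; rewrite -/(bform _ _ _) Bw mxE le_eqVlt => /orP[/eqP w0|//].
    by move: h; rewrite -w0 mulr0 ler10.
  apply: (Amin (w ord0 ord_max)^-1); first by rewrite invr_gt0.
  split; first by rewrite linearB /= AT tr_diag_mx.
  move=> v; rewrite mulmxBr mulmxBl mxE -/(bform _ _ _) [X in _ + X]mxE.
  rewrite -/(bform (diag_mx _) v v) [bform (diag_mx _) v v]bform_sum.
  have -> : \sum_i \sum_j v i ord0 * diag_mx (\row_(i0 < m.+1)
     (if i0.+1 == m.+1 then (w ord0 ord_max)^-1 else 0)) i j * v j ord0
     = (w ord0 ord_max)^-1 * v ord_max ord0 ^+ 2.
    rewrite (bigD1 ord_max) //= (bigD1 ord_max) //= !mxE !eqxx.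
    rewrite big1 => [|j jm]; last first.
      by rewrite !mxE [ord_max == j]eq_sym (negPf jm) mulr0n mulr0 mul0r.
    rewrite big1 => [|i im]; last first.
      rewrite big1 // => j _; rewrite !mxE eqSS.
      have -> : (i == m :> nat) = false by apply/negP => /eqP e; case/eqP: im; apply: val_inj.
      by rewrite mul0rn mulr0 mul0r.
    by rewrite !addr0 mulr1n; ring.
  by rewrite subr_ge0 mulrC ler_pdivrMr.
rewrite submxE => /eqP nz.
have [j hj] : exists j, (delta_mx ord0 ord_max *m cokermx A : 'rV[R]_m.+1) ord0 j != 0.
  apply: contrapT => nj; apply: nz; apply/rowP => j; rewrite [RHS]mxE.
  by apply/eqP; apply: contrapT => /negP ?; apply: nj; exists j.
exists (col j (cokermx A)); split.
  by rewrite colE mulmxA mulmx_coker mul0mx.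
by move: hj; rewrite -rowE !mxE.
Qed.

End PositiveForms.

Section HankelKernel.
Context {R : realType}.
Implicit Types (a : int -> R) (u v : nat -> R) (m s t : nat).

(** The vector (v_0, ..., v_(m-1)) is in the kernel of the Hankel matrix of size m.
    Vectors are sequences, so that they can be shifted; other entries are ignored. *)
Definition hankel_ker a m v :=
  forall i, (i < m)%N -> \sum_(j < m) a (i + j + 1)%N * v j = 0.

Lemma hankel_kerP a m v : hankel_ker a m v <-> Hankel a m *m (\col_(j < m) v j) = 0.
Proof.
split=> H.
  apply/colP => i; rewrite !mxE -[RHS](H i (ltn_ord i)).
  by apply: eq_bigr => j _; rewrite !mxE.
move=> i im; have := congr1 (fun B : 'cV[R]_m => B (Ordinal im) ord0) H.
rewrite !mxE => h; rewrite -[RHS]h; apply: eq_bigr => j _; by rewrite !mxE.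
Qed.

(** The sequence v moved t places to the right. *)
Definition shiftv t (v : nat -> R) j := if (j < t)%N then 0 else v (j - t)%N.

(** If the kernel contains a vector u with nonzero last entry, then it is stable
    under the shift, as long as no nonzero entry is shifted out: all entries of H (shift
    v) but the last are entries of H v, and the last one is zero because u H (shift v)
    = 0. *)
Lemma hankel_ker_shift a m u v : (0 < m)%N -> hankel_ker a m u -> u m.-1 != 0 ->
  hankel_ker a m v -> v m.-1 = 0 -> hankel_ker a m (shiftv 1 v).
Proof.
move=> m0 Ku um Kv vm.
have K1 i : (i < m.-1)%N -> \sum_(j < m) a (i + j + 1)%N * shiftv 1 v j = 0.
  move=> im; rewrite -[RHS](Kv i.+1); last by lia.
  case: m m0 vm {Ku um Kv im} => // m' _ /= vm.
  rewrite big_ord_recl /shiftv /= mulr0 add0r [RHS]big_ord_recr /= vm mulr0 addr0.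
  by apply: eq_bigr => j _; rewrite /bump /=; congr (a _ * v _); lia.
move=> i im; have [im'|im'] := ltnP i m.-1; first exact: K1.
have -> : i = m.-1 by lia.
set T := \sum_(j < m) _.
have : \sum_(k < m) u k * \sum_(j < m) a (k + j + 1)%N * shiftv 1 v j = 0.
  under eq_bigr do rewrite mulr_sumr.
  rewrite exchange_big /= big1 // => j _.
  transitivity (shiftv 1 v j * \sum_(k < m) a (j + k + 1)%N * u k).
    by rewrite mulr_sumr; apply: eq_bigr => k _; rewrite (addnC j); ring.
  by rewrite Ku ?mulr0.
have lm : (m.-1 < m)%N by rewrite prednK.
rewrite (bigD1 (Ordinal lm)) //= -/T big1 => [|k km]; last first.
  rewrite K1 ?mulr0 //; have := ltn_ord k.
  have : (k : nat) != m.-1 by apply: contra km => /eqP e; apply/eqP/val_inj.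
  lia.
by rewrite addr0 => /eqP; rewrite mulf_eq0 (negPf um) => /eqP.
Qed.

Lemma shiftvS t v : shiftv t.+1 v = shiftv 1 (shiftv t v).
Proof.
apply/funext => -[|j]; first by rewrite /shiftv.
by rewrite /shiftv /= !ltnS subn1 /= subSS.
Qed.

Lemma hankel_ker_shifts a m u v s t : (s < m)%N -> hankel_ker a m u -> u m.-1 != 0 ->
  hankel_ker a m v -> (forall k, (s < k)%N -> v k = 0) -> (t + s < m)%N -> hankel_ker a m (shiftv t v).
Proof.
move=> sm Ku um Kv vs; elim: t => [|t IH] ts.
  have -> // : shiftv 0 v = v by apply/funext => j; rewrite /shiftv subn0.
rewrite shiftvS; apply: (hankel_ker_shift _ Ku um).
- exact: leq_ltn_trans sm.
- by apply: IH; exact: ltnW.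
- by rewrite /shiftv ifF ?vs //; lia.
Qed.

(** The shifts of a kernel vector whose last nonzero entry is v_s express that the
    sequence a_1, ..., a_(2 m - 1) satisfies a linear recurrence of order s. *)
Lemma hankel_ker_recurrence a m u v s : (s < m)%N -> hankel_ker a m u -> u m.-1 != 0 ->
  hankel_ker a m v -> v s != 0 -> (forall k, (s < k)%N -> v k = 0) ->
  exists g : nat -> R, g 0%N = -1 /\
    forall l, (s < l < m.*2)%N -> \sum_(k < s.+1) g k * a (l - k)%N = 0.
Proof.
move=> sm Ku um Kv vs0 vs; exists (fun k => - v (s - k)%N / v s); split.
  by rewrite subn0 mulNr divff.
move=> l /andP[sl lm].
(* Row i of the kernel relation of the t-fold shift, where i + t = l - s - 1. *)
pose i := minn m.-1 (l - s.+1); pose t := (l - s.+1 - i)%N.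
have it : (i + t = l - s.+1)%N by rewrite /t /i; lia.
have im : (i < m)%N by rewrite /i; lia.
have ts : (t + s < m)%N by rewrite /t /i; lia.
have := hankel_ker_shifts sm Ku um Kv vs ts im.
have -> : \sum_(j < m) a (i + j + 1)%N * shiftv t v j =
   \sum_(0 <= k < s.+1) a (l - s + k)%N * v k.
  rewrite -(big_mkord xpredT (fun j => a (i + j + 1)%N * shiftv t v j)).
  rewrite (big_cat_nat (leq0n t)) /=; last by lia.
  rewrite big_nat_cond big1 => [|j /andP[/andP[_ jt] _]]; last by rewrite /shiftv jt mulr0.
  rewrite add0r (@big_cat_nat _ _ _ (t + s.+1)%N) /=; [|lia|lia].
  rewrite [X in _ + X]big_nat_cond [X in _ + X]big1 => [|j /andP[/andP[jt _] _]]; last first.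
    by rewrite /shiftv vs ?if_same ?mulr0 //; lia.
  rewrite addr0 -{1}[t]add0n big_addn (addnC t) addnK.
  rewrite big_nat_cond [RHS]big_nat_cond.
  apply: eq_bigr => j _; rewrite /shiftv ifF ?addnK; last by lia.
  by congr (a _%N * _); lia.
rewrite big_mkord => h.
rewrite (reindex_inj rev_ord_inj) /=.
transitivity (- (v s)^-1 * \sum_(k < s.+1) a (l - s + k)%N * v k); last by rewrite h mulr0.
rewrite mulr_sumr; apply: eq_bigr => k _; have := ltn_ord k => ks.
rewrite subSS subKn //; have -> : (l - (s - k) = l - s + k)%N by lia.
ring.
Qed.

End HankelKernel.

(** * Degenerate positive Hankel matrices *)

Section HankelStructure.
Context {R : realType}.
Implicit Types (a : int -> R) (u v w g c : nat -> R) (m s t r : nat).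

(** A kernel vector v whose last nonzero index s is the least possible, together with
    a kernel vector u with nonzero last entry. *)
Lemma minimal_kernel a m : (0 < m)%N -> SE_minimally_positive (Hankel a m) ->
  exists u v s, [/\ (s < m)%N, hankel_ker a m u /\ u m.-1 != 0,
    [/\ hankel_ker a m v, v s != 0 & forall k, (s < k)%N -> v k = 0] &
    forall w, hankel_ker a m w -> (forall k, (s <= k)%N -> w k = 0) -> forall k, w k = 0].
Proof.
case: m => // m _ /SE_minimal_ker[u' [Hu um]].
pose u k := if (k < m.+1)%N then u' (inord k) ord0 else 0.
have uE : \col_(j < m.+1) u j = u'.
  by apply/colP => j; rewrite mxE /u ltn_ord inord_val.
have Ku : hankel_ker a m.+1 u by apply/hankel_kerP; rewrite uE.
have um' : u m != 0.
  by rewrite /u ltnSn -[m in inord m]/(nat_of_ord (@ord_max m)) inord_val.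
pose P s := `[< exists v, [/\ hankel_ker a m.+1 v, v s != 0 & forall k, (s < k)%N -> v k = 0] >].
have exP : exists s, P s.
  exists m; apply/asboolP; exists u; split => // k mk.
  by rewrite /u ltnNge mk.
case: (ex_minnP exP) => s /asboolP[v [Kv vs v0]] smin.
exists u, v, s; split => //.
  by rewrite ltnS; apply: smin; apply/asboolP; exists u; split => // k mk; rewrite /u ltnNge mk.
move=> w Kw ws.
have H d : forall k, (s - d <= k)%N -> w k = 0.
  elim: d => [|d IH] k; first by rewrite subn0; exact: ws.
  have [sd|sd] := leqP (s - d) k; first by move=> _; exact: IH.
  move=> kd; apply/eqP; apply: contrapT => /negP wk.
  have : (s <= k)%N.
    apply: smin; apply/asboolP; exists w; split => // l kl; apply: IH.
    by apply: leq_trans kl; lia.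
  by lia.
by move=> k; apply: (H s); rewrite subnn.
Qed.

Lemma bform_Hankel a m v w :
  bform (Hankel a m) (\col_(i < m) v i) (\col_(i < m) w i) =
  \sum_(i < m) \sum_(j < m) v i * a (i + j + 1)%N * w j.
Proof.
by rewrite bform_sum; apply: eq_bigr => i _; apply: eq_bigr => j _; rewrite !mxE.
Qed.

(** Positive definiteness of the quadratic form of A. *)
Definition posdef m (A : 'M[R]_m) := forall v : 'cV[R]_m, 0 <= bform A v v /\
  (bform A v v = 0 -> v = 0).

(** The leading block of size s is positive definite if no nonzero kernel vector is
    supported on the first s indices: a null vector of its form, extended by zero, is a
    null vector of the whole form, hence a kernel vector. *)
Lemma leading_posdef a m s : (s <= m)%N -> psd (Hankel a m) ->
  (forall w, hankel_ker a m w -> (forall k, (s <= k)%N -> w k = 0) -> forall k, w k = 0) ->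
  posdef (Hankel a s).
Proof.
move=> sm Hpsd Hinj v.
case: s sm Hinj v => [|s] sm Hinj v.
  by split; rewrite bform_sum big_ord0 // => _; apply/colP => -[].
pose w k := if (k < s.+1)%N then v (inord k) ord0 else 0.
have vE : v = \col_(i < s.+1) w i by apply/colP => i; rewrite mxE /w ltn_ord inord_val.
have w0 k : (s.+1 <= k)%N -> w k = 0 by move=> sk; rewrite /w ltnNge sk.
have bE : bform (Hankel a s.+1) v v = bform (Hankel a m) (\col_(i < m) w i) (\col_(i < m) w i).
  rewrite vE !bform_Hankel.
  have ext (F : nat -> R) : (forall k, (s.+1 <= k)%N -> F k = 0) ->
      \sum_(i < s.+1) F i = \sum_(i < m) F i.
    move=> F0; rewrite -!(big_mkord xpredT F) [RHS](big_cat_nat (leq0n s.+1) sm) /=.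
    rewrite [X in _ + X]big_nat_cond [X in _ + X]big1 ?addr0 // => k /andP[/andP[sk _] _].
    exact: F0.
  under eq_bigr => i _.
    rewrite (ext (fun j => w i * a (i + j + 1)%N * w j)); last first.
      by move=> k sk; rewrite (w0 k sk) mulr0.
    over.
  rewrite (ext (fun i => \sum_(j < m) w i * a (i + j + 1)%N * w j)) // => k sk.
  by rewrite big1 // => j _; rewrite (w0 k sk) !mul0r.
rewrite bE; split; first by case: Hpsd => _; apply.
move=> /(psd_ker Hpsd)/hankel_kerP Kw; rewrite vE; apply/colP => i; rewrite !mxE.
exact: Hinj.
Qed.

Lemma posdef_unitmx m (A : 'M[R]_m) : posdef A -> A \in unitmx.
Proof.
move=> Apos; rewrite -row_free_unit; apply: inj_row_free => w wA.
have [_ h] := Apos w^T; rewrite -[w]trmxK h ?linear0 //.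
by rewrite /bform trmxK wA mul0mx mxE.
Qed.

(** With a positive definite leading block of size s and a recurrence of order s, the
    rank is s: the recurrence puts every row in the span of the first s rows. *)
Lemma Hankel_rank a m s g : (s < m)%N -> posdef (Hankel a s) -> g 0%N = -1 ->
  (forall l, (s < l < m.*2)%N -> \sum_(k < s.+1) g k * a (l - k)%N = 0) ->
  \rank (Hankel a m) = s.
Proof.
move=> sm Hpos g0 rec; apply/eqP; rewrite eqn_leq; apply/andP; split; last first.
  pose E : 'M[R]_(s, m) := \matrix_(i, j) (i == j :> nat)%:R.
  have EA : Hankel a s = E *m Hankel a m *m E^T.
    have EM p (B : 'M[R]_(m, p)) i j : (E *m B) i j = B (widen_ord (ltnW sm) i) j.
      rewrite mxE (bigD1 (widen_ord (ltnW sm) i)) //= mxE eqxx mul1r big1 ?addr0 //.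
      move=> k ki; rewrite mxE (_ : (i == k :> nat) = false) ?mul0r //.
      by apply/negP => /eqP e; case/eqP: ki; apply: val_inj.
    apply/matrixP => i j; rewrite -[_ *m E^T]trmxK trmx_mul trmxK [RHS]mxE EM [RHS]mxE EM !mxE.
    by [].
  rewrite -(mxrank_unit (posdef_unitmx Hpos)) EA.
  by apply: leq_trans (mxrankM_maxl _ _) (mxrankM_maxr _ _).
pose f := widen_ord (ltnW sm).
have sub : (Hankel a m <= rowsub f (Hankel a m))%MS.
  apply/row_subP => i; move: {2}(nat_of_ord i).+1 (ltnSn i) => n; elim: n i => // n IH i.
  rewrite ltnS => ni; have [is_|si] := ltnP i s.
    have -> : row i (Hankel a m) = row (Ordinal is_) (rowsub f (Hankel a m)).
      by apply/rowP => j; rewrite !mxE.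
    exact: row_sub.
  have lt k : (i - k.+1 < m)%N by have := ltn_ord i; lia.
  have -> : row i (Hankel a m) =
      \sum_(k < s) g k.+1 *: row (Ordinal (lt k)) (Hankel a m).
    apply/rowP => j; rewrite summxE.
    have := rec (i + j + 1)%N; rewrite big_ord_recl g0 subn0 => h.
    have {}h := h (ltac:(have := ltn_ord i; have := ltn_ord j; lia)).
    rewrite mxE mxE; apply/eqP; rewrite -subr_eq0 -oppr_eq0 opprB addrC.
    rewrite mulN1r in h; rewrite -[X in _ == X]h; apply/eqP; congr (_ + _).
    apply: eq_bigr => k _; rewrite !mxE lift0 /=; congr (_ * a _).
    have ks : (k < s)%N by exact: ltn_ord k.
    by rewrite /=; lia.
  apply: summx_sub => k _; apply: scalemx_sub; apply: IH => /=.
  by have := ltn_ord k; lia.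
exact: leq_trans (mxrankS sub) (rank_leq_row _).
Qed.

(** An SE-minimally positive Hankel matrix of rank r is the extension of its leading
    block of size r, which is positive definite, by the recurrence with coefficients c. *)
Theorem hankel_structure a m r c : (0 < m)%N ->
  SE_minimally_positive (Hankel a m) -> \rank (Hankel a m) = r ->
  c 0%N = -1 ->
  \row_(j < r) c (r - j)%N = (\row_(j < r) a (r + j + 1)%N) *m invmx (Hankel a r) ->
  [/\ (r < m)%N, posdef (Hankel a r) &
    forall l, (r < l < m.*2)%N -> \sum_(k < r.+1) c k * a (l - k)%N = 0].
Proof.
move=> m0 SE rk c0 cE.
have [u [v [s [sm [Ku um] [Kv vs v0] inj]]]] := minimal_kernel m0 SE.
have [g [g0 rec]] := hankel_ker_recurrence sm Ku um Kv vs v0.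
have [Hpsd _] := SE.
have Hpos := leading_posdef (ltnW sm) Hpsd inj.
have sr : s = r by rewrite -rk (Hankel_rank sm Hpos g0 rec).
rewrite {s}sr in sm Kv vs v0 inj rec Hpos *.
split => // l lr; rewrite -[RHS](rec l lr); apply: eq_bigr => k _; congr (_ * _).
have Hu := posdef_unitmx Hpos.
have gE : \row_(j < r) g (r - j)%N = (\row_(j < r) a (r + j + 1)%N) *m invmx (Hankel a r).
  apply: (canRL (mulmxK Hu)); apply/rowP => j; rewrite !mxE.
  have := rec (r + j + 1)%N (ltac:(have := ltn_ord j; lia)).
  rewrite big_ord_recl g0 subn0 mulN1r => /eqP; rewrite addrC subr_eq0 => /eqP <-.
  rewrite (reindex_inj rev_ord_inj) /=; apply: eq_bigr => i _; rewrite !mxE.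
  rewrite /bump /=; have ir : (i < r)%N by exact: ltn_ord i.
  by congr (g _ * a _); lia.
case: k => -[|k] kr /=; first by rewrite c0 g0.
have jr : (r - k.+1 < r)%N by lia.
have := congr1 (fun B : 'rV[R]_r => B ord0 (Ordinal jr)) (etrans cE (esym gE)).
by rewrite !mxE /= subKn.
Qed.

(** The recurrence extends to the index 2 m exactly when a_(2 m) has the prescribed
    value; only the sufficiency is stated. *)
Lemma hankel_last a m r c : (r < m)%N -> posdef (Hankel a r) ->
  c 0%N = -1 ->
  (forall l, (r < l < m.*2)%N -> \sum_(k < r.+1) c k * a (l - k)%N = 0) ->
  a m.*2 = ((\row_(j < r) a (m + j)%N) *m invmx (Hankel a r)
              *m (\col_(i < r) a (m + i + 1)%N)) ord0 ord0 ->
  \sum_(k < r.+1) c k * a (m.*2 - k)%N = 0.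
Proof.
move=> rm Hpos c0 rec.
set lam := _ *m invmx _ => aE.
have lamE : lam *m Hankel a r = \row_(j < r) a (m + j)%N.
  by rewrite mulmxKV // posdef_unitmx.
have rec' l : (r < l < m.*2)%N -> a l = \sum_(k < r) c k.+1 * a (l - k.+1)%N.
  move=> lr; have := rec l lr; rewrite big_ord_recl c0 subn0 mulN1r => /eqP.
  by rewrite addrC subr_eq0 => /eqP <-.
(* Row m - 1 is the combination lam of the first r rows, in all columns j < m. *)
have lamj j : (j < m)%N -> a (m + j)%N = \sum_(i < r) lam ord0 i * a (i + j + 1)%N.
  elim/ltn_ind: j => j IH jm; have [jr|rj] := ltnP j r.
    have := congr1 (fun B : 'rV[R]_r => B ord0 (Ordinal jr)) lamE.
    by rewrite !mxE /= => <-; apply: eq_bigr => i _; rewrite !mxE.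
  rewrite rec'; last by lia.
  transitivity (\sum_(k < r) c k.+1 * \sum_(i < r) lam ord0 i * a (i + (j - k.+1) + 1)%N).
    apply: eq_bigr => k _; have := ltn_ord k => kr.
    rewrite -IH; [congr (_ * a _)|..]; lia.
  under eq_bigr do rewrite mulr_sumr.
  rewrite exchange_big /=; apply: eq_bigr => i _.
  rewrite [in RHS]rec'; last by have := ltn_ord i; lia.
  rewrite mulr_sumr; apply: eq_bigr => k _; have := ltn_ord k => kr.
  by rewrite mulrCA; congr (_ * (_ * a _)); lia.
rewrite big_ord_recl c0 subn0 mulN1r aE mxE.
apply/eqP; rewrite addrC subr_eq0; apply/eqP.
transitivity (\sum_(k < r) c k.+1 * \sum_(i < r) lam ord0 i * a (i + (m - k.+1) + 1)%N).
  apply: eq_bigr => k _; have := ltn_ord k => kr.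
  rewrite -lamj; last by lia.
  by rewrite ?lift0; congr (_ * a _); lia.
under eq_bigr do rewrite mulr_sumr.
rewrite exchange_big /=; apply: eq_bigr => i _; rewrite mxE.
rewrite [in RHS]rec'; last by have := ltn_ord i; lia.
rewrite mulr_sumr; apply: eq_bigr => k _; have := ltn_ord k => kr.
by rewrite mulrCA; congr (_ * (_ * a _)); lia.
Qed.

End HankelStructure.

(** * The Bezoutian of a linear recurrence *)

Section Bezoutian.
Variable T : comNzRingType.
Variables (a c : nat -> T) (r : nat).

(** The entry of index i of the product of the triangular Toeplitz matrix of c by
    (1, z, ..., z^(r-1)): the sum of c_(p-i) z^p over i <= p < r. *)
Definition bezout_vec i (z : T) : T :=
  \sum_(p < r) (if (i <= p)%N then c (p - i)%N else 0) * z ^+ p.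

Lemma bezout_vec_shift i z : (i < r)%N ->
  z * bezout_vec i z = bezout_vec i.+1 z + c (r - i.+1)%N * z ^+ r.
Proof.
rewrite /bezout_vec mulr_sumr; case: r => // r' ir.
rewrite big_ord_recr [X in _ = X + _]big_ord_recl /= mul0r add0r.
have -> : (i <= r')%N by [].
rewrite subSS exprS mulrCA -exprS; congr (_ + _).
apply: eq_bigr => p _; rewrite /bump /= add1n ltnS subSS exprS; ring.
Qed.

Lemma bezout_vec_top z : bezout_vec r z = 0.
Proof. by rewrite /bezout_vec big1 // => p _; rewrite leqNgt ltn_ord /= mul0r. Qed.

Lemma cauchy_prod_rev p : (p < r)%N ->
  cauchy_prod c a p = \sum_(i < r) a i * (if (i <= p)%N then c (p - i)%N else 0).
Proof.
move=> pr; rewrite /cauchy_prod (reindex_inj rev_ord_inj) /=.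
rewrite (big_ord_widen r (fun k => c (p.+1 - k.+1)%N * a (p - (p.+1 - k.+1))%N)) //.
rewrite big_mkcond /=; apply: eq_bigr => i _; rewrite ltnS.
by case: ifP => ip; [rewrite subSS subKn // mulrC | rewrite mulr0].
Qed.

Lemma sum_bezout_vec z :
  \sum_(i < r) a i * bezout_vec i z = \sum_(p < r) cauchy_prod c a p * z ^+ p.
Proof.
under eq_bigr do rewrite /bezout_vec mulr_sumr.
rewrite exchange_big /=; apply: eq_bigr => p _.
by rewrite cauchy_prod_rev // mulr_suml; apply: eq_bigr => i _; rewrite mulrA.
Qed.

Lemma bezout_vec0 z : bezout_vec 0 z + c r * z ^+ r = \sum_(p < r.+1) c p * z ^+ p.
Proof.
rewrite big_ord_recr; congr (_ + _); apply: eq_bigr => p _.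
by rewrite leq0n subn0.
Qed.

Hypothesis r0 : (0 < r)%N.
Hypothesis rec : forall l, (r < l < r.*2)%N -> \sum_(k < r.+1) c k * a (l - k)%N = 0.

(** The recurrence with coefficients c, read along column j of the Hankel matrix. *)
Lemma bez_column j : (j < r)%N ->
  \sum_(i < r) a (i + j + 1)%N * c (r - i.+1)%N =
  (if j == 0%N then cauchy_prod c a r else 0) - c r * a j.
Proof.
move=> jr; rewrite (reindex_inj rev_ord_inj) /=.
have -> : (if j == 0%N then cauchy_prod c a r else 0) = \sum_(k < r.+1) c k * a (r + j - k)%N.
  by case: j jr => [|j] jr /=; [rewrite addn0|rewrite rec //; lia].
rewrite big_ord_recr /= addKn addrK; apply: eq_bigr => k _.
by rewrite mulrC; congr (c _ * a _); have := ltn_ord k; lia.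
Qed.

Lemma shift_sum (f : nat -> T) : f r = 0 ->
  \sum_(i < r) f i.+1 = \sum_(i < r) f i - f 0%N.
Proof.
move=> fr; have : \sum_(i < r.+1) f i = \sum_(i < r) f i by rewrite big_ord_recr /= fr addr0.
by rewrite big_ord_recl => <-; rewrite addrAC subrr add0r.
Qed.

(** One half of the Bezoutian identity: the product by z of the Hankel form. The double
    sum of a_(i+j) terms is symmetric in z and w, and cancels in the difference. *)
Lemma bezout_half z w :
  z * (\sum_(i < r) \sum_(j < r) a (i + j + 1)%N * bezout_vec i z * bezout_vec j w) =
  \sum_(i < r) \sum_(j < r) a (i + j)%N * bezout_vec i z * bezout_vec j w
  - bezout_vec 0 z * (\sum_(j < r) a j * bezout_vec j w)
  + z ^+ r * (cauchy_prod c a r * bezout_vec 0 w - c r * \sum_(j < r) a j * bezout_vec j w).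
Proof.
rewrite mulr_sumr.
have e1 (i : 'I_r) : z * (\sum_(j < r) a (i + j + 1)%N * bezout_vec i z * bezout_vec j w) =
   \sum_(j < r) a (i.+1 + j)%N * bezout_vec i.+1 z * bezout_vec j w +
   z ^+ r * \sum_(j < r) a (i + j + 1)%N * c (r - i.+1)%N * bezout_vec j w.
  rewrite !mulr_sumr -big_split /=; apply: eq_bigr => j _.
  have -> : z * (a (i + j + 1)%N * bezout_vec i z * bezout_vec j w) =
     a (i + j + 1)%N * (z * bezout_vec i z) * bezout_vec j w by ring.
  by rewrite bezout_vec_shift // addSn addn1; ring.
under eq_bigr do rewrite e1.
rewrite big_split /=; congr (_ + _).
  rewrite (shift_sum (f := fun i => \sum_(j < r) a (i + j)%N * bezout_vec i z * bezout_vec j w)).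
    congr (_ - _); rewrite mulr_sumr; apply: eq_bigr => j _; rewrite add0n; ring.
  by rewrite big1 // => j _; rewrite bezout_vec_top mulr0 mul0r.
rewrite -mulr_sumr; congr (_ * _); rewrite exchange_big /=.
transitivity (\sum_(j < r) ((if j == 0%N :> nat then cauchy_prod c a r else 0) - c r * a j) * bezout_vec j w).
  apply: eq_bigr => j _; rewrite -bez_column // mulr_suml.
  by apply: eq_bigr.
rewrite (eq_bigr _ (fun j _ => mulrBl _ _ _)) sumrB [c r * _]mulr_sumr.
congr (_ - _); last by apply: eq_bigr => j _; rewrite mulrA.
rewrite (bigD1 (Ordinal r0)) //= big1 ?addr0 // => j j0.
have -> : (j == 0%N :> nat) = false by apply/negP => /eqP e; case/eqP: j0; apply: val_inj.
by rewrite mul0r.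
Qed.

(** The Bezoutian of N and Q, where N / Q has the Taylor coefficients a, is congruent
    to the Hankel matrix of a by a triangular Toeplitz matrix. *)
Theorem bezoutian z w :
  (\sum_(j < r.+1) cauchy_prod c a j * z ^+ j) * (\sum_(j < r.+1) c j * w ^+ j) -
  (\sum_(j < r.+1) cauchy_prod c a j * w ^+ j) * (\sum_(j < r.+1) c j * z ^+ j) =
  (z - w) * \sum_(i < r) \sum_(j < r) a (i + j + 1)%N * bezout_vec i z * bezout_vec j w.
Proof.
have sym (b : nat -> T) : \sum_(i < r) \sum_(j < r) b (i + j)%N * bezout_vec i z * bezout_vec j w =
    \sum_(i < r) \sum_(j < r) b (i + j)%N * bezout_vec i w * bezout_vec j z.
  rewrite exchange_big /=; apply: eq_bigr => i _; apply: eq_bigr => j _.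
  by rewrite addnC; ring.
rewrite mulrBl bezout_half (sym (fun k => a (k + 1)%N)) bezout_half (sym a).
rewrite -!bezout_vec0 ![\sum_(j < r.+1) cauchy_prod c a j * _]big_ord_recr /= -!sum_bezout_vec.
ring.
Qed.

End Bezoutian.

(** * The interpolant is a Pick function *)

Section Interpolant.
Context {R : realType}.
Implicit Types (a : int -> R) (c : nat -> R) (r : nat) (x : R) (z s : Cplx R).

(** The numerator and the denominator of the interpolant, without its pole, as
    polynomials in z - x. *)
Definition num_poly a c r : {poly R} :=
  \poly_(j < r.+1) cauchy_prod c (fun k => a k) j.

Definition den_poly c r : {poly R} := \poly_(j < r.+1) c j.

(** The interpolant without its pole at x. *)
Definition reg_part x a r c z : Cplx R :=
  (cpoly (num_poly a c r)).[z - x%:C] / (cpoly (den_poly c r)).[z - x%:C].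

Lemma cpoly_polyE n (E : nat -> R) s :
  (cpoly (\poly_(j < n) E j)).[s] = \sum_(j < n) (E j)%:C * s ^+ j.
Proof.
rewrite /cpoly (@horner_coef_wide _ n); last first.
  by rewrite size_map_poly size_poly.
by apply: eq_bigr => j _; rewrite coef_map coef_poly ltn_ord.
Qed.

Lemma boundary_interpolantE x a r c z :
  boundary_interpolant x a r c z = (a (-1))%:C / (z - x%:C) + reg_part x a r c z.
Proof.
rewrite /boundary_interpolant /reg_part !cpoly_polyE; congr (_ + _ / _); last by rewrite big_mkord.
by rewrite big_mkord; apply: eq_bigr => j _; rewrite big_mkord.
Qed.

Lemma cauchy_prod_real a c j :
  cauchy_prod (fun k => (c k)%:C : Cplx R) (fun k => (a k%:Z)%:C : Cplx R) j =
  (cauchy_prod c (fun k => a k) j)%:C.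
Proof. by rewrite /cauchy_prod rmorph_sum; apply: eq_bigr => k _; rewrite rmorphM. Qed.

(** Complex conjugation. *)
Definition cconj z : Cplx R := conjc z.

Lemma Re_cconj z : Rez (cconj z) = Rez z. Proof. by case: z. Qed.
Lemma Im_cconj z : Imz (cconj z) = - Imz z. Proof. by case: z. Qed.
Lemma cconjD z w : cconj (z + w) = cconj z + cconj w.
Proof. by apply: cplx_eq; rewrite !(ReD, ImD, Re_cconj, Im_cconj) // opprD. Qed.
Lemma cconjM z w : cconj (z * w) = cconj z * cconj w.
Proof. by apply: cplx_eq; rewrite !(ReM, ImM, Re_cconj, Im_cconj); ring. Qed.
Lemma cconjC (t : R) : cconj (t%:C) = t%:C.
Proof. by apply: cplx_eq; rewrite !(Re_cconj, Im_cconj) ?ImC ?oppr0. Qed.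
Lemma cconjX z n : cconj (z ^+ n) = cconj z ^+ n.
Proof. by elim: n => [|n IH]; [rewrite !expr0 (cconjC 1)|rewrite !exprS cconjM IH]. Qed.
Lemma cconj_sum n (F : 'I_n -> Cplx R) :
  cconj (\sum_(i < n) F i) = \sum_(i < n) cconj (F i).
Proof. by elim/big_rec2: _ => [|i y z _ <-]; [exact: (cconjC 0)|rewrite cconjD]. Qed.
Lemma cconj_horner (P : {poly R}) s : cconj (cpoly P).[s] = (cpoly P).[cconj s].
Proof.
rewrite !horner_coef cconj_sum; apply: eq_bigr => i _.
by rewrite cconjM cconjX coef_map cconjC.
Qed.

Lemma cconj_bezout_vec c r i s :
  cconj (bezout_vec (fun k => (c k)%:C) r i s) = bezout_vec (fun k => (c k)%:C) r i (cconj s).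
Proof.
rewrite /bezout_vec cconj_sum; apply: eq_bigr => p _; rewrite cconjM cconjX.
by congr (_ * _); case: ifP => _; [rewrite cconjC|exact: (cconjC 0)].
Qed.

(** [bezoutian] at s and its conjugate: Im (N conj(Q)) is Im s times the value of the
    Hankel form at the complex vector u. *)
Lemma Im_num_den a c r s : (0 < r)%N ->
  (forall l, (r < l < r.*2)%N -> \sum_(k < r.+1) c k * a (l - k)%N = 0) ->
  let u (i : nat) := bezout_vec (fun k => (c k)%:C : Cplx R) r i s in
  0 < Imz s ->
  Imz ((cpoly (num_poly a c r)).[s] * cconj (cpoly (den_poly c r)).[s]) =
  Imz s * (bform (Hankel a r) (\col_(i < r) Rez (u i)) (\col_(i < r) Rez (u i)) +
           bform (Hankel a r) (\col_(i < r) Imz (u i)) (\col_(i < r) Imz (u i))).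
Proof.
move=> r0 rec u s0; set N := (cpoly _).[s]; set Q := (cpoly _).[s].
pose ac k : Cplx R := (a (Posz k))%:C; pose cc k : Cplx R := (c k)%:C.
have recC l : (r < l < r.*2)%N -> \sum_(k < r.+1) cc k * ac (l - k)%N = 0.
  move=> lr; transitivity ((\sum_(k < r.+1) c k * a (l - k)%N)%:C : Cplx R).
    by rewrite rmorph_sum; apply: eq_bigr => k _; rewrite rmorphM.
  by rewrite rec.
have := bezoutian r0 recC s (cconj s).
have NE t : \sum_(j < r.+1) cauchy_prod cc ac j * t ^+ j = (cpoly (num_poly a c r)).[t].
  by rewrite cpoly_polyE; apply: eq_bigr => j _; rewrite cauchy_prod_real.
have QE t : \sum_(j < r.+1) cc j * t ^+ j = (cpoly (den_poly c r)).[t].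
  by rewrite cpoly_polyE.
rewrite !NE !QE -!cconj_horner -/N -/Q.
set S := \sum_(i < r) _ => E.
have S0 : Rez S = bform (Hankel a r) (\col_(i < r) Rez (u i)) (\col_(i < r) Rez (u i)) +
           bform (Hankel a r) (\col_(i < r) Imz (u i)) (\col_(i < r) Imz (u i)).
  have Re_sum n (F : 'I_n -> Cplx R) : Rez (\sum_(i < n) F i) = \sum_(i < n) Rez (F i).
    by elim/big_rec2: _ => [|i y z _ <-] //; rewrite ReD.
  rewrite (bform_Hankel a r (fun i => Rez (u i)) (fun i => Rez (u i))).
  rewrite (bform_Hankel a r (fun i => Imz (u i)) (fun i => Imz (u i))).
  rewrite -big_split /= /S Re_sum; apply: eq_bigr => i _.
  rewrite Re_sum -big_split /=; apply: eq_bigr => j _.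
  rewrite -cconj_bezout_vec -/(u i) -/(u j) !(ReM, ImM) ReC ImC Re_cconj Im_cconj; ring.
rewrite -S0.
have := congr1 (fun z : Cplx R => Imz z) E.
rewrite !(ImD, ImN, ImM, ReM, ReD, ReN, Re_cconj, Im_cconj).
lra.
Qed.

Lemma Im_div (N Q : Cplx R) : Imz (N / Q) = Imz (N * cconj Q) / cabs Q ^+ 2.
Proof. by rewrite !ImM ImV ReV Re_cconj Im_cconj mulrDl !mulrA. Qed.

(** At a zero of Q the Hankel form vanishes at u, so u = 0, but the last entry of u is
    - s^(r-1). *)
Lemma den_upper_neq0 a c r x z : (0 < r)%N -> posdef (Hankel a r) -> c 0%N = -1 ->
  (forall l, (r < l < r.*2)%N -> \sum_(k < r.+1) c k * a (l - k)%N = 0) ->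
  upper_half_plane z -> (cpoly (den_poly c r)).[z - x%:C] != 0.
Proof.
move=> r0 Hpos c0 rec zP; apply/negP => /eqP Q0.
set s := z - x%:C in Q0; have s0 : 0 < Imz s by rewrite /s ImD ImN ImC subr0.
have := Im_num_den r0 rec s0; rewrite Q0 (cconjC 0) mulr0 /=.
set u1 := \col_(i < r) _; set u2 := \col_(i < r) _ => /esym/eqP.
rewrite mulf_eq0 gt_eqF //=.
have [p1 z1] := Hpos u1; have [p2 z2] := Hpos u2.
rewrite paddr_eq0 // => /andP[/eqP/z1 e1 /eqP/z2 e2].
have lr : (r.-1 < r)%N by rewrite prednK.
have ur : bezout_vec (fun k => (c k)%:C : Cplx R) r r.-1 s = 0.
  apply: cplx_eq.
    by have := congr1 (fun B : 'cV[R]_r => B (Ordinal lr) ord0) e1; rewrite !mxE.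
  by have := congr1 (fun B : 'cV[R]_r => B (Ordinal lr) ord0) e2; rewrite !mxE.
move: ur; rewrite /bezout_vec (bigD1 (Ordinal lr)) //= leqnn subnn c0 big1 => [|p pr].
  move/eqP; rewrite addr0 mulf_eq0 -cabs_eq0 cabs_real normr_eq0 oppr_eq0 oner_eq0 /=.
  by rewrite expf_eq0 (negPf (upper_neq_real x zP)) andbF.
rewrite ifF ?mul0r //; apply/negP => rp; case/eqP: pr; apply: val_inj => /=.
by have := ltn_ord p; lia.
Qed.

Lemma den_at0 c r x : c 0%N = -1 -> (cpoly (den_poly c r)).[x%:C - x%:C] != 0.
Proof.
move=> c0; rewrite subrr cpoly0 horner_coef0 coef_poly /= c0.
by rewrite -cabs_eq0 cabs_real normr_eq0 oppr_eq0 oner_eq0.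
Qed.

Lemma reg_part_Pick a c r x : (0 < r)%N -> posdef (Hankel a r) -> c 0%N = -1 ->
  (forall l, (r < l < r.*2)%N -> \sum_(k < r.+1) c k * a (l - k)%N = 0) ->
  Pick_regular_at x (reg_part x a r c).
Proof.
move=> r0 Hpos c0 rec; split.
- move=> z zP; apply: regular_div; [exact: regular_horner|exact: regular_horner|].
  exact: (den_upper_neq0 _ r0 Hpos).
- apply: regular_div; [exact: regular_horner|exact: regular_horner|exact: den_at0].
- move=> z zP; rewrite Im_div; apply: divr_ge0; last by rewrite exprn_ge0 ?cabs_ge0.
  have s0 : 0 < Imz (z - x%:C) by rewrite ImD ImN ImC subr0.
  rewrite Im_num_den //; apply: mulr_ge0; first exact: ltW.
  by apply: addr_ge0; exact: (proj1 (Hpos _)).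
Qed.

(** The Taylor coefficients of N / Q at x are those of the data, as far as the recurrence
    holds: Q times the sum of the a_k s^k, k <= n, differs from N by a multiple of s^(n+1). *)
Lemma reg_part_coef a c r x n : c 0%N = -1 ->
  (forall l, (r < l <= n)%N -> \sum_(k < r.+1) c k * a (l - k)%N = 0) ->
  exists d, taylor_at d (reg_part x a r c) x%:C /\ forall k, (k <= n)%N -> d k = (a k)%:C.
Proof.
move=> c0 rec.
have FA : regular_at (reg_part x a r c) x%:C.
  by apply: regular_div; [exact: regular_horner|exact: regular_horner|exact: den_at0].
case: FA => d dF; exists d; split => //.
(* The first nonzero coefficient of N / Q - A cannot have index p <= n, because
   N / Q - A = - s^(n+1) R1 / Q. *)
pose A : {poly R} := \poly_(j < n.+1) a j.
have diff := taylor_sub dF (taylor_poly (cpoly A) x%:C).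
suff H k : (k <= n)%N -> d k - (cpoly A)`_k = 0.
  move=> k kn; apply/eqP; have := H k kn.
  by rewrite coef_map coef_poly ltnS kn => /eqP; rewrite subr_eq0.
pose B := den_poly c r * A - num_poly a c r.
have [R1 RE] : exists R1 : {poly R}, B = R1 * 'X^(n.+1).
  exists (drop_poly n.+1 B); rewrite -[LHS](poly_take_drop n.+1).
  suff -> : take_poly n.+1 B = 0 by rewrite add0r.
  apply/polyP => i; rewrite coef_take_poly coef0; case: ifP => //; rewrite ltnS => li.
  rewrite coefB coefM !coef_poly.
  have e (j : 'I_i.+1) : (den_poly c r)`_j * A`_(i - j) =
      (if (j < r.+1)%N then c j else 0) * a (i - j)%N.
    by rewrite !coef_poly (_ : (i - j < n.+1)%N) //; have := ltn_ord j; lia.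
  rewrite (eq_bigr _ (fun j _ => e j)).
  have [ir|ri] := ltnP i r.+1.
    apply/eqP; rewrite subr_eq0; apply/eqP; apply: eq_bigr => j _.
    by rewrite ifT // (leq_trans (ltn_ord j)).
  rewrite subr0 -[RHS](rec i); last by lia.
  rewrite [RHS](big_ord_widen i.+1 (fun j => c j * a (i - j)%N)); last exact: ltnW.
  by rewrite [RHS]big_mkcond; apply: eq_bigr => j _; case: ifP => //; rewrite mul0r.
have [[z0 _]|[p [g [dk d0 gA gx gE]]]] := taylor_zero_order diff.
  by move=> ?; exact: z0.
have [np|np] := ltnP n p; first by move=> kn; apply: d0; exact: leq_ltn_trans np.
exfalso; move/eqP: dk; apply; rewrite -gx.
have : g x%:C = - ((x%:C - x%:C) ^+ (n.+1 - p) *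
    ((cpoly R1).[x%:C - x%:C] / (cpoly (den_poly c r)).[x%:C - x%:C])).
  have Q0 := den_at0 r x c0.
  have QA : regular_at (fun z => (cpoly (den_poly c r)).[z - x%:C]) x%:C by exact: regular_horner.
  apply: (regular_eq gA (g := fun z => - ((z - x%:C) ^+ (n.+1 - p) *
    ((cpoly R1).[z - x%:C] / (cpoly (den_poly c r)).[z - x%:C])))).
    have := regular_mul (regular_cst (-1) x%:C) (regular_mul (regular_horner 'X^(n.+1 - p) x%:C x%:C)
      (regular_div (regular_horner (cpoly R1) x%:C x%:C) QA Q0)).
    by apply: regular_near; near=> z; rewrite mulN1r hornerXn.
  have := regular_neq0_near QA Q0; apply: filterS => z Qz zx.
  have s0 : z - x%:C != 0 by rewrite subr_eq0.
  apply: (mulfI (expf_neq0 p s0)); rewrite -gE /reg_part.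
  rewrite mulrN mulrA -exprD subnKC; last exact: leqW.
  have := congr1 (fun P => (cpoly P).[z - x%:C]) RE.
  rewrite /cpoly rmorphB !rmorphM /= map_polyXn hornerD hornerN !hornerM hornerXn -!/(cpoly _).
  move=> h; rewrite mulrA [_ ^+ n.+1 * _]mulrC -h.
  by rewrite -/(cpoly (den_poly c r)) -/(cpoly (num_poly a c r)); field.
by rewrite subrr expr0n subn_eq0 leqNgt ltnS np /= mul0r oppr0.
Unshelve. all: by end_near. Qed.

End Interpolant.

(** * Laurent expansions of Pick functions *)

Section Laurent.
Context {R : realType}.
Implicit Types (a : int -> R) (c : nat -> R) (r : nat) (x : R) (z s p : Cplx R).
Implicit Types (f g h : Cplx R -> Cplx R).

Lemma dnbhs_near p (P : Cplx R -> Prop) :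
  (\forall z \near p^', P z) <-> (\forall z \near p, z != p -> P z).
Proof. by []. Qed.

(** A Laurent series starting at the exponent - N becomes a power series after
    multiplication by (z - p)^N. The case z = p gives the value of the sum at p. *)
Lemma laurent_taylor g p (b : int -> Cplx R) N :
  (\forall z \near p^',
      series (fun k : nat => b (k%:Z - N%:Z) * (z - p) ^ (k%:Z - N%:Z)) @ \oo --> g z) ->
  taylor_at (fun k => b (k%:Z - N%:Z))
     (fun z => if z == p then b (- N%:Z) else (z - p) ^+ N * g z) p.
Proof.
move=> /dnbhs_near H; apply: series_taylor; apply: filterS H => z Hz.
apply/cvg_cabsP => e e0; case: (eqVneq z p) => [->|zp].
  exists 1%N => -[//|n] _; rewrite series_taylor_sum subrr taylor_sum_at0 sub0r.
  by rewrite subrr cabs0.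
have s0 : z - p != 0 by rewrite subr_eq0.
have sN : 0 < cabs ((z - p) ^+ N) by rewrite cabs_gt0 expf_neq0.
have /cvg_cabsP/(_ _ (divr_gt0 e0 sN)) [K HK] := Hz zp.
exists K => n Kn; have := HK n Kn; rewrite ltr_pdivlMr // -cabsM mulrC mulrBr.
suff -> : (z - p) ^+ N * series (fun k : nat => b (k%:Z - N%:Z) * (z - p) ^ (k%:Z - N%:Z)) n
  = series (fun k => b (k%:Z - N%:Z) * (z - p) ^+ k) n by [].
rewrite /series /= mulr_sumr; apply: eq_bigr => k _.
rewrite mulrCA; congr (_ * _); rewrite [_ ^+ N]exprnP -expfzDr // [RHS]exprnP; congr (_ ^ _); lia.
Qed.

(** A Pick function has at most a simple pole at x, so that f - b_(-1) / (z - x)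
    extends to an analytic function with coefficients b_0, b_1, ... *)
Lemma laurent_regular x f g (b : int -> Cplx R) :
  (forall z, upper_half_plane z -> 0 <= Imz (f z)) ->
  (\forall z \near (x%:C : Cplx R)^', upper_half_plane z -> g z = f z) ->
  laurent_coefs g x%:C b ->
  exists2 ext, taylor_at (fun k => b k%:Z) ext x%:C &
    \forall z \near (x%:C : Cplx R), upper_half_plane z ->
      f z - b (-1) / (z - x%:C) = ext z.
Proof.
move=> fP /dnbhs_near gf [N [bN /laurent_taylor]].
set e := fun k : nat => _; set h := fun z => _ => hPS.
have hE : \forall z \near (x%:C : Cplx R), upper_half_plane z -> h z = (z - x%:C) ^+ N * f z.
  apply: filterS gf => z gf zP; have s0 := upper_neq_real x zP.
  by rewrite /h ifN ?gf // -subr_eq0.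
have e0 j : (j.+1 < N)%N -> e j = 0.
  have [[ez _] _|[k [q [ek ek0 qA qx qE]]] jN] := taylor_zero_order hPS; first exact: ez.
  have [|Nk] := leqP k.+2 N; last by apply: ek0; lia.
  move=> kN; exfalso.
  apply: (no_high_pole (k := N - k) (h := q) (x := x)) => //; first by lia.
    by rewrite qx.
  apply: filterS hE => z hz zP; have := hz zP; rewrite qE => qf.
  have s0 := upper_neq_real x zP.
  suff -> : q z / (z - x%:C) ^+ (N - k) = f z by exact: fP.
  apply: (canLR (mulfK (expf_neq0 _ s0))).
  apply: (mulfI (expf_neq0 k s0)); rewrite qf -[in LHS](@subnKC k N); last by lia.
  by rewrite exprD; ring.
case: N => [|N] in bN e h hPS hE e0 *.
  exists h.
    by apply: taylor_ext hPS => k; rewrite /e subr0.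
  by apply: filterS hE => z hz zP; rewrite bN // mul0r subr0 hz // expr0 mul1r.
have e0' j : (j < N)%N -> e j = 0 by move=> jN; apply: e0.
have := taylor_shift e0' hPS; set G := fun z => _ => GPS.
have eN : e N = b (-1) by rewrite /e; congr b; lia.
have := taylor_sub GPS (taylor_cst (b (-1)) x%:C); set d := fun k : nat => _ => dPS.
have d0 j : (j < 1)%N -> d j = 0 by case: j => // _; rewrite /d add0n eN subrr.
have := taylor_shift d0 dPS; set ext := fun z => _ => extPS.
exists ext.
  apply: taylor_ext extPS => k; rewrite /d addn1 subr0 /e; congr b; lia.
apply: filterS hE => z hz zP; have s0 := upper_neq_real x zP.
have zx : z != x%:C by rewrite -subr_eq0.
rewrite /ext (negPf zx) /G (negPf zx) (hz zP) expr1 exprS.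
have sN : (z - x%:C) ^+ N != 0 by exact: expf_neq0.
by field; rewrite sN s0.
Qed.

Lemma regular_pole (a : Cplx R) x z : z - x%:C != 0 ->
  regular_at (fun z => a / (z - x%:C)) z.
Proof. by move=> s0; apply: regular_div; [exact: regular_cst|exact: regular_id|]. Qed.

(** Subtracting the pole at x of a Pick function leaves a Pick function, analytic at x.
    The values of phi outside the half-plane are those of the analytic extension. *)
Lemma solution_regular x f g (b : int -> Cplx R) (a1 : R) : Pick f -> a1 <= 0 ->
  (\forall z \near (x%:C : Cplx R)^', upper_half_plane z -> g z = f z) ->
  laurent_coefs g x%:C b -> b (-1) = a1%:C -> Imz (b 0) = 0 ->
  exists phi, [/\ Pick_regular_at x phi, taylor_at (fun k => b k%:Z) phi x%:C &
    forall z, upper_half_plane z -> f z = a1%:C / (z - x%:C) + phi z].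
Proof.
move=> [fA fP] a10 gf gb b1 b0.
have [ext extPS extE] := laurent_regular fP gf gb; rewrite b1 in extE.
pose phi z := if 0 < Imz z then f z - a1%:C / (z - x%:C) else ext z.
have phiP z : upper_half_plane z -> phi z = f z - a1%:C / (z - x%:C).
  by rewrite /upper_half_plane /phi /= => ->.
have phiPS : taylor_at (fun k => b k%:Z) phi x%:C.
  apply: taylor_near extPS; apply: filterS extE => z ez; rewrite /phi.
  by case: ifP => // /ez ->.
have phiA z : upper_half_plane z -> regular_at phi z.
  move=> zP; have : regular_at (fun z => f z - a1%:C / (z - x%:C)) z.
    apply: regular_sub; first by apply/analytic_atP; exact: fA.
    exact: regular_pole (upper_neq_real x zP).
  apply: regular_near; apply: filterS (open_nbhs_nbhs (conj open_upper zP)) => w wP.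
  by rewrite phiP.
exists phi; split => //; last by move=> z zP; rewrite phiP // addrC subrK.
have phix : regular_at phi x%:C by eexists; exact: phiPS.
split => //; apply: (@pole_removal R x (- a1) f phi) => //.
- by rewrite oppr_ge0.
- by move=> z zP; rewrite phiP // rmorphN mulNr.
- by rewrite (taylor_val phiPS) b0.
Qed.

(** Functions with the same first k Taylor coefficients agree to order k. *)
Lemma taylor_agree p (c d : nat -> Cplx R) f g k : taylor_at c f p ->
  taylor_at d g p -> (forall j, (j < k)%N -> c j = d j) ->
  exists2 e, regular_at e p & \forall z \near p, f z = g z + (z - p) ^+ k * e z.
Proof.
move=> fP gP cd; have D := taylor_sub fP gP.
have d0 j : (j < k)%N -> c j - d j = 0 by move=> /cd ->; rewrite subrr.
eexists; first by eexists; exact: taylor_shift d0 D.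
near=> z => /=; case: eqVneq => [->|zp].
  rewrite subrr; case: k d0 {cd} => [|k] d0.
    by rewrite expr0 mul1r (taylor_val fP) (taylor_val gP) addrC subrK.
  by rewrite expr0n mul0r addr0 (taylor_val fP) (taylor_val gP); apply/eqP; rewrite -subr_eq0 d0.
have sk : (z - p) ^+ k != 0 by rewrite expf_neq0 // subr_eq0.
by rewrite mulrC divfK // addrC subrK.
Unshelve. all: by end_near. Qed.

(** The Laurent coefficients of a1 / (z - p) + h, where h has Taylor coefficients d. *)
Definition laurent_coef_fun (a1 : Cplx R) (d : nat -> Cplx R) (k : int) : Cplx R :=
  match k with Posz k => d k | Negz 0 => a1 | Negz _ => 0 end.

Lemma laurent_simple_pole (a1 : Cplx R) d h p : taylor_at d h p ->
  laurent_coefs (fun z => a1 / (z - p) + h z) p (laurent_coef_fun a1 d).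
Proof.
move=> hPS; exists 1%N; split; first by case=> [k|[|k]] //; lia.
apply/dnbhs_near; apply: filterS (taylor_series hPS) => z /cvg_cabsP hz zp.
apply/cvg_cabsP => e e0; have [K HK] := hz e e0.
exists K.+1 => -[//|n]; rewrite ltnS => Kn.
rewrite /series /= big_nat_recl //= opprD addrACA.
have -> : (0%:Z - 1%:Z) = -1 by lia.
rewrite /= exprN1 subrr add0r.
have := HK n Kn; rewrite /series /=; congr (cabs (_ - _) < _).
apply: eq_bigr => k _; have -> : (k.+1%:Z - 1%:Z) = k by lia.
by rewrite subn1.
Qed.

End Laurent.

(** * Existence and uniqueness of the interpolant *)

Theorem theorem8p1 (R : realType) (n : nat) (x : R) (a : int -> R)
    (r : nat) (c : nat -> R) :
  let m := (n.+1)./2 in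
  (1 <= n)%N ->
  a (-1) <= 0 ->
  SE_minimally_positive (Hankel a m) ->
  \rank (Hankel a m) = r ->
  (1 <= r)%N ->
  (~~ odd n ->
     a n = ((\row_(j < r) a (m + j)%N) *m invmx (Hankel a r)
              *m (\col_(i < r) a (m + i + 1)%N)) ord0 ord0) ->
  c 0%N = -1 ->
  \row_(j < r) c (r - j)%N =
    (\row_(j < r) a (r + j + 1)%N) *m invmx (Hankel a r) ->
  bCFP_solution n x (fun k => (a k)%:C) (boundary_interpolant x a r c) /\
  (forall f : Cplx R -> Cplx R,
     bCFP_solution n x (fun k => (a k)%:C) f ->
     forall z, upper_half_plane z -> f z = boundary_interpolant x a r c z).
Proof.
move=> m n1 a1 SE rk r1 an c0 cE.
have m0 : (0 < m)%N by rewrite /m; lia.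
have [rm Hpos rec] := hankel_structure m0 SE rk c0 cE.
have recn l : (r < l <= n)%N -> \sum_(k < r.+1) c k * a (l - k)%N = 0.
  move=> /andP[rl ln]; have [lm|ml] := ltnP l m.*2; first by apply: rec; rewrite rl.
  (* The index l = 2 m occurs only for even n, and is then n. *)
  have nE : n = m.*2 by move: ml ln; rewrite /m; lia.
  have -> : l = m.*2 by lia.
  apply: (hankel_last rm Hpos c0 rec); rewrite -[in LHS]nE; apply: an.
  by rewrite nE odd_double.
have rec2 l : (r < l < r.*2)%N -> \sum_(k < r.+1) c k * a (l - k)%N = 0.
  by move=> lr; apply: rec; lia.
have FP := reg_part_Pick x r1 Hpos c0 rec2.
have [d [dPS da]] := reg_part_coef x c0 recn.
have [F0A F0x F0P] := FP.
have BE : boundary_interpolant x a r c = (fun z => (a (-1))%:C / (z - x%:C) + reg_part x a r c z).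
  by apply/funext => z; exact: boundary_interpolantE.
split.
  rewrite BE; split.
    split=> z zP.
      apply/analytic_atP; apply: regular_add; last exact: F0A.
      exact: regular_pole (upper_neq_real x zP).
    rewrite ImD; apply: addr_ge0; last exact: F0P.
    rewrite ImM ImV ReC ImC mul0r addr0 mulr_le0 //.
    rewrite mulNr oppr_le0 divr_ge0 ?exprn_ge0 ?cabs_ge0 //.
    by rewrite ImD ImN ImC subr0 ltW.
  exists (fun z => (a (-1))%:C / (z - x%:C) + reg_part x a r c z).
  exists (laurent_coef_fun (a (-1))%:C d).
  split; last 2 first.
  - exact: laurent_simple_pole.
  - case=> [k|[|k]] //.
    by move=> /andP[_ kn]; apply: da.
  split.
  - apply/dnbhs_near; have := regular_neq0_near
      (regular_horner (cpoly (den_poly c r)) x%:C x%:C) (den_at0 r x c0).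
    apply: filterS => z Qz zx; apply/analytic_atP; apply: regular_add.
      by apply: regular_pole; rewrite subr_eq0.
    by apply: regular_div => //; exact: regular_horner.
  - by apply/dnbhs_near; near=> z.
  - exists 1%N, (fun z => (a (-1))%:C + (z - x%:C) * reg_part x a r c z); split.
      apply/analytic_atP; apply: regular_add; first exact: regular_cst.
      by apply: regular_mul => //; exact: regular_id.
    apply/dnbhs_near; near=> z => zx; have s0 : z - x%:C != 0 by rewrite subr_eq0.
    by rewrite expr1; field.
move=> f [fPick [g [b [[_ gf _] gb ba]]]] z zP.
have b1 : b (-1) = (a (-1))%:C by apply: ba; lia.
have b0 : Imz (b 0) = 0 by rewrite ba // lexx.
have [phi [phiPick phiPS fE]] := solution_regular fPick a1 gf gb b1 b0.
rewrite fE // boundary_interpolantE; congr (_ + _).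
have Q0 : (den_poly c r).[0] != 0.
  by rewrite horner_coef0 coef_poly /= c0 oppr_eq0 oner_eq0.
apply: (rigidity (r := r.+1) (N := num_poly a c r) (Q := den_poly c r) _ _ Q0 FP phiPick) zP.
- exact: size_poly.
- exact: size_poly.
- move=> w wP; rewrite /reg_part mulrCA divff ?mulr1 //.
  exact: (den_upper_neq0 x r1 Hpos).
- have := regular_neq0_near
      (regular_horner (cpoly (den_poly c r)) x%:C x%:C) (den_at0 r x c0).
  by apply: filterS => w Qw; rewrite /reg_part mulrCA divff ?mulr1.
- apply: (taylor_agree phiPS dPS) => j jr.
  have jn : (j <= n)%N by move: rm jr; rewrite /m; lia.
  by rewrite da // ba //; lia.
Unshelve. all: by end_near. Qed.
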